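(* There is an algorithm that, given matroids $M_1=(E_1,\mathcal B_1),\dots,M_k=(E_k,\mathcal B_k)$ accessed via basis oracles (each query evaluable in time polynomial in $|E_i|$) and two feasible basis sequences $\mathbb B$ and $\mathbb B'$ of $\mathbb M=(M_1,\dots,M_k)$, decides in polynomial time whether $\mathbb B$ is reconfigurable to $\mathbb B'$. Moreover, if the answer is affirmative, a reconfiguration sequence between $\mathbb B$ and $\mathbb B'$ can be computed in polynomial time.
   Context: A matroid $M=(E,\mathcal B)$ is a finite set $E$ with a nonempty family $\mathcal B\subseteq 2^E$ (bases) such that for distinct $B,B'\in\mathcal B$ and $x\in B\setminus B'$ there is $y\in B'\setminus B$ with $B-x+y\in\mathcal B$. A basis oracle for $M$ answers, given $X\subseteq E$, whether $X\in\mathcal B$. The ground sets $E_i$ may intersect. A basis sequence of $\mathbb M$ is $(B_1,\dots,B_k)$ with $B_i\in\mathcal B_i$; it is feasible if $B_i\cap B_j=\emptyset$ for all $i\ne j$. Two feasible basis sequences $(B_1,\dots,B_k)$ and $(B'_1,\dots,B'_k)$ are adjacent if there is $i$ with $B_j=B'_j$ for all $j\neq i$ and $B'_i=B_i-x+y$ for some $x\in B_i$, $y\in E_i\setminus B_i$. $\mathbb B$ is reconfigurable to $\mathbb B'$ if there are feasible basis sequences $\mathbb B_0=\mathbb B,\mathbb B_1,\dots,\mathbb B_\ell=\mathbb B'$ with $\mathbb B_{i-1},\mathbb B_i$ adjacent for all $i\in[\ell]$; such a tuple is a reconfiguration sequence of length $\ell$. Polynomial time means polynomial in $\sum_i|E_i|$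 (and $k$), counting oracle calls. *)

(* Defs.v *)
From mathcomp Require Import all_boot all_algebra.
Set Implicit Arguments.
Unset Strict Implicit.
Unset Printing Implicit Defensive.

(* All ground sets live in one ambient finite type [T], so that they may
   intersect. The size of [T] itself is never part of an input size. *)
Record matroid (T : finType) := Matroid {
  ground : {set T};
  bases : {set {set T}};
  bases_ground : forall B, B \in bases -> B \subset ground;
  bases_neq0 : bases != set0;
  bases_exchange : forall B B', B \in bases -> B' \in bases -> B != B' ->
    forall x, x \in B :\: B' ->
    exists2 y, y \in B' :\: B & y |: (B :\ x) \in bases
}.

Section Reconfiguration.
Variables (T : finType) (k : nat) (M : 'I_k -> matroid T).
Implicit Types B : {ffun 'I_k -> {set T}}.

Definition feasible B : bool :=
  [forall i, B i \in bases (M i)] &&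
  [forall i, forall j, (i != j) ==> [disjoint B i & B j]].

Definition adjacent B B' : bool :=
  [exists i, [forall j, (j != i) ==> (B j == B' j)] &&
    [exists x in B i, exists y in ground (M i) :\: B i,
       B' i == y |: (B i :\ x)]].

(* [s] lists B_0, ..., B_l, both endpoints included. *)
Definition reconfiguration_sequence B B' (s : seq {ffun 'I_k -> {set T}}) :=
  if s is B0 :: s' then
    [&& B0 == B, last B0 s' == B', all feasible s & path adjacent B0 s']
  else false.

Definition reconfigurable B B' : Prop :=
  exists s, reconfiguration_sequence B B' s.

End Reconfiguration.

(* Algorithms are programs of a first-order, call-by-value functional language
   over binary trees, in the style of N. D. Jones's language F. The elements of
   the ground sets are opaque leaves of these trees: programs contain no
   literal for them and can only test two of them for equality. Matroids are
   accessible through oracle queries only. Every operation takes one unit of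
   time, plus the time taken by the oracle for a query. An operation allocates
   at most one tree node, and the variables in scope are bounded in number by
   the program text, so that (with shared subtrees) this cost measure is
   polynomially related to Turing machine time. *)

Inductive value (T : Type) :=
| Nil
| Elt of T
| Pair of value T & value T.
Arguments Nil {T}.

Inductive expr :=
| EVar of nat                  (* de Bruijn index into the environment *)
| ENil
| EPair of expr & expr
| EFst of expr
| ESnd of expr
| EEqElt of expr & expr        (* equality test on ground set elements *)
| EIf of expr & expr & expr    (* [Nil] is false, anything else is true *)
| ELet of expr & expr          (* binds index 0 in the second argument *)
| ECall of nat & seq expr
| EQuery of expr & expr.       (* index of a matroid, list of elements *)

(* The bodies of mutually recursive functions, the main one first. In a body,
   [EVar 0], [EVar 1], ... are the arguments. *)
Definition program := seq expr.

Section Values.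
Variable T : Type.

Definition vbool (b : bool) : value T := if b then Pair Nil Nil else Nil.
Definition vnat (n : nat) : value T := iter n (Pair Nil) Nil.
Definition vlist (s : seq (value T)) : value T := foldr (@Pair T) Nil s.
Definition velts (s : seq T) : value T := vlist [seq Elt x | x <- s].

Definition vfst (v : value T) := if v is Pair a _ then a else Nil.
Definition vsnd (v : value T) := if v is Pair _ b then b else Nil.
Definition vtrue (v : value T) := if v is Nil then false else true.

End Values.

Definition veqelt (T : eqType) (v w : value T) : bool :=
  match v, w with Elt x, Elt y => x == y | _, _ => false end.

(* [orc i s = Some (b, c)] : the [i]-th oracle accepts the query [s], and
   answers [b] after [c] time units. A query with [orc i s = None] is illegal,
   and a program issuing one has no result. *)
Definition oracle (T : Type) := nat -> seq T -> option (bool * nat).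

(* [eval orc P rho e v t] : in environment [rho], the expression [e] evaluates
   to [v] in time [t]. *)
Section Semantics.
Variables (T : eqType) (orc : oracle T) (P : program).

Inductive eval : seq (value T) -> expr -> value T -> nat -> Prop :=
| eval_var rho n : eval rho (EVar n) (nth Nil rho n) 1
| eval_nil rho : eval rho ENil Nil 1
| eval_pair rho e1 e2 v1 v2 t1 t2 :
    eval rho e1 v1 t1 -> eval rho e2 v2 t2 ->
    eval rho (EPair e1 e2) (Pair v1 v2) (t1 + t2).+1
| eval_fst rho e v t : eval rho e v t -> eval rho (EFst e) (vfst v) t.+1
| eval_snd rho e v t : eval rho e v t -> eval rho (ESnd e) (vsnd v) t.+1
| eval_eqelt rho e1 e2 v1 v2 t1 t2 :
    eval rho e1 v1 t1 -> eval rho e2 v2 t2 ->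
    eval rho (EEqElt e1 e2) (vbool T (veqelt v1 v2)) (t1 + t2).+1
| eval_if rho e e1 e2 v w t u :
    eval rho e v t -> eval rho (if vtrue v then e1 else e2) w u ->
    eval rho (EIf e e1 e2) w (t + u).+1
| eval_let rho e1 e2 v1 v2 t1 t2 :
    eval rho e1 v1 t1 -> eval (v1 :: rho) e2 v2 t2 ->
    eval rho (ELet e1 e2) v2 (t1 + t2).+1
| eval_call rho f es vs v t u :
    evals rho es vs t -> eval vs (nth ENil P f) v u ->
    eval rho (ECall f es) v (t + u).+1
| eval_query rho e1 e2 i s b c t1 t2 :
    eval rho e1 (vnat T i) t1 -> eval rho e2 (velts s) t2 ->
    orc i s = Some (b, c) ->
    eval rho (EQuery e1 e2) (vbool T b) (t1 + t2 + size s + c).+1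
with evals : seq (value T) -> seq expr -> seq (value T) -> nat -> Prop :=
| evals_nil rho : evals rho [::] [::] 0
| evals_cons rho e es v vs t u :
    eval rho e v t -> evals rho es vs u ->
    evals rho (e :: es) (v :: vs) (t + u).

Definition run (args : seq (value T)) (v : value T) (t : nat) : Prop :=
  eval args (nth ENil P 0) v t.

End Semantics.

Record instance := Instance {
  elt : finType;
  num : nat;
  mat : 'I_num -> matroid elt;
  source : {ffun 'I_num -> {set elt}};
  target : {ffun 'I_num -> {set elt}};
  source_feasible : feasible mat source;
  target_feasible : feasible mat target
}.

Definition instance_size (I : instance) : nat :=
  \sum_(i < num I) #|ground (mat (i : 'I_(num I)))| + num I.

(* [tau i X] is the time taken by the oracle of [M i] on the query [X]; legal
   queries are the subsets of the ground set of [M i]. *)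
Definition basis_oracle (T : finType) (k : nat) (M : 'I_k -> matroid T)
    (tau : 'I_k -> {set T} -> nat) : oracle T := fun i s =>
  if insub i is Some j then
    let X := [set x in s] in
    if X \subset ground (M j) then Some (X \in bases (M j), tau j X) else None
  else None.

(* Sets are given as duplicate-free lists in an arbitrary order. *)
Definition encodes_set (T : finType) (v : value T) (A : {set T}) : Prop :=
  exists s : seq T, [/\ uniq s, s =i A & v = velts s].

Fixpoint encodes_seq (T X : Type) (R : value T -> X -> Prop)
    (v : value T) (xs : seq X) : Prop :=
  match xs, v with
  | [::], Nil => True
  | x :: xs', Pair a w => R a x /\ encodes_seq R w xs'
  | _, _ => False
  end.

Definition encodes_family (T : finType) (k : nat)
    (v : value T) (A : 'I_k -> {set T}) : Prop :=
  encodes_seq (@encodes_set T) v [seq A i | i <- enum 'I_k].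

Definition encodes_families (T : finType) (k : nat)
    (v : value T) (s : seq {ffun 'I_k -> {set T}}) : Prop :=
  encodes_seq (fun w (A : {ffun 'I_k -> {set T}}) => encodes_family w A) v s.

(* The three arguments of an algorithm are the lists (E_1, ..., E_k),
   (B_1, ..., B_k) and (B'_1, ..., B'_k). The time bound may depend on the
   polynomial [q] bounding the evaluation time of the oracles, but the
   algorithm may not. *)
Definition poly_time_algorithm (pre : instance -> Prop)
    (post : forall I : instance, value (elt I) -> Prop) : Prop :=
  exists P : program, forall q : {poly nat}, exists p : {poly nat},
  forall (I : instance) (tau : 'I_(num I) -> {set elt I} -> nat)
    (vE vB vB' : value (elt I)),
  (forall (i : 'I_(num I)) (X : {set elt I}),
     X \subset ground (mat i) -> tau i X <= q.[#|ground (mat i)|]%R) ->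
  encodes_family vE (fun i => ground (mat i)) ->
  encodes_family vB (source I) ->
  encodes_family vB' (target I) ->
  pre I ->
  exists (v : value (elt I)) (t : nat),
    [/\ run (basis_oracle (@mat I) tau) P [:: vE; vB; vB'] v t,
        t <= p.[instance_size I]%R & post I v].

(* Main.v *)
Require Import Defs.
From mathcomp Require Import all_boot all_algebra.
From mathcomp Require Import zify.
Set Implicit Arguments.
Unset Strict Implicit.
Unset Printing Implicit Defensive.

(* Modify the source family B by forward and the target family C by backward
   moves until they agree. For f outside B_i and w in B_i, write f -> w if
   B_i - w + f is a basis; a move is f -> w with f in no B_j.
   If some free f -> w has f in C_i and w not in C_i, that move brings B closer
   to C. Otherwise, dual exchange and equality of cardinalities show that B and C
   have the same free elements. Then search backward from the misplaced elements
   (those in some B_i but not in C_i) for a shortest path f -> w -> ... from a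
   free element. If w is misplaced, moving it in B makes a move of the first kind
   possible. If not, the fundamental circuit of f in B_i lies in C_i + f, so the
   same move is possible in B and in C; it does not change the distance and, the
   path being shortest, keeps the rest of the path, which is now shorter. If
   there is no path, the set V of elements from which misplaced ones are reached
   contains no free element and no arc enters V from outside, so that no sequence
   of moves changes B_i on V, and C cannot be reached. *)

(** * Matroid exchange *)

Section Exchange.
Variables (T : finType) (M : matroid T).
Implicit Types A B C : {set T}.

Lemma basis_exchange B C x : B \in bases M -> C \in bases M -> x \in B -> x \notin C ->
  exists y, [/\ y \in C, y \notin B & y |: (B :\ x) \in bases M].
Proof.
move=> HB HC xB xC; have nBC : B != C by apply: contraNneq xC => <-.
have xD : x \in B :\: C by rewrite inE xC.
have [y] := bases_exchange HB HC nBC xD.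
by rewrite inE => /andP[yB yC] H; exists y.
Qed.

Lemma bases_sub_eq B C : B \in bases M -> C \in bases M -> B \subset C -> B = C.
Proof.
move=> HB HC sBC; apply/eqP; rewrite eqEsubset sBC; apply/subsetP=> y yC.
apply/negPn/negP=> yB.
have [z [zB zC _]] := basis_exchange HC HB yC yB.
by rewrite (subsetP sBC) in zC.
Qed.

(** Induction on the difference [B :\: C]: an exchange towards [C] keeps the cardinality and shrinks
    the difference. *)
Lemma card_bases B C : B \in bases M -> C \in bases M -> #|B| = #|C|.
Proof.
move=> + HC; move: {2}_.+1 (ltnSn #|B :\: C|) => n.
elim: n B => // n IHn B lt_n HB.
have [sBC|/subsetPn[x xB xC]] := boolP (B \subset C).
  by rewrite (bases_sub_eq HB HC sBC).
have [y [yC yB Hy]] := basis_exchange HB HC xB xC.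
rewrite -(IHn _ _ Hy); first by rewrite cardsU1 !inE (negPf yB) andbF (cardsD1 x B) xB.
apply: leq_trans (_ : _ <= #|B :\: C|) _ => //; apply: proper_card; apply/properP; split.
  apply/subsetP=> z; rewrite !inE => /andP[zC /orP[/eqP zy|/andP[_ ->]]]; last by rewrite zC.
  by rewrite zy yC in zC.
by exists x; rewrite !inE ?xB ?xC // eqxx /= orbF; apply: contraNneq yB => <-.
Qed.

(** Among the bases containing [y] and [B :&: C], take [X] with fewest elements outside [B]. An
    element of [X :\: B] other than [y] could be exchanged for one of [B], against minimality. So
    [y] is the only such element, and exchanging any [x] of [B] outside [X] towards [X] brings in
    [y]. *)
Lemma basis_exchange_dual B C y : B \in bases M -> C \in bases M -> y \in C -> y \notin B ->
  exists x, [/\ x \in B, x \notin C & y |: (B :\ x) \in bases M].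
Proof.
move=> HB HC yC yB.
pose Q X := [&& X \in bases M, y \in X & B :&: C \subset X].
have QC : Q C by rewrite /Q HC yC subsetIr.
case: (arg_minnP (fun X => #|X :\: B|) QC) => X /and3P[HX yX sX] minX.
have [sXB|/subsetPn[z]] := boolP (X :\: B \subset [set y]).
  have [/(bases_sub_eq HB HX) eBX|/subsetPn[x xB xX]] := boolP (B \subset X).
    by rewrite eBX yX in yB.
  have [y' [yX' yB' Hy]] := basis_exchange HB HX xB xX.
  have /(subsetP sXB) : y' \in X :\: B by rewrite inE yB'.
  rewrite inE => /eqP ey; rewrite ey in Hy; exists x; split=> //.
  by apply: contra xX => xC; apply: (subsetP sX); rewrite inE xB.
rewrite !inE => /andP[zB zX] zy.
have [u [uB uX Hu]] := basis_exchange HX HB zX zB.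
have /minX : Q (u |: (X :\ z)).
  rewrite /Q Hu !inE (eq_sym y z) zy yX orbT /=; apply/subsetP=> v vBC;
    rewrite !inE (subsetP sX) //.
  by rewrite andbT (_ : v != z) ?orbT //; apply: contraNneq zB => <-; case/setIP: vBC.
rewrite leqNgt => /negP[]; apply: proper_card; apply/properP; split.
  apply/subsetP=> v; rewrite !inE => /andP[vB /orP[/eqP vu|/andP[_ ->]]]; last by rewrite vB.
  by rewrite vu uB in vB.
exists z; rewrite !inE ?zB ?zX // eqxx /= orbF.
by apply: contraNneq zB => ->.
Qed.

(** Exchanging [y] out of [B - x + a] towards [B - y + b] brings in [b] or [x]; with [x] the result
    would be [B - y + a], which is not a basis. *)
Lemma double_exchange B a b x y : B \in bases M ->
  a \notin B -> b \notin B -> a != b -> x \in B -> y \in B -> x != y ->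
  a |: (B :\ x) \in bases M -> b |: (B :\ y) \in bases M -> a |: (B :\ y) \notin bases M ->
  b |: ((a |: (B :\ x)) :\ y) \in bases M.
Proof.
move=> HB aB bB ab xB yB xy Ha Hb Nay.
have yA : y \in a |: (B :\ x) by rewrite !inE yB (eq_sym y x) xy orbT.
have yC : y \notin b |: (B :\ y) by rewrite !inE eqxx orbF; apply: contraNneq bB => <-.
have [z [zC zA Hz]] := basis_exchange Ha Hb yA yC.
have : z \in [set b; x].
  move: zC zA; rewrite !inE; case: (z =P b) => //= _ /andP[_ ->]; case: (z =P x) => //=.
  by rewrite orbT.
rewrite !inE => /orP[] /eqP ez; rewrite ez // in Hz.
case/negP: Nay; suff -> : a |: (B :\ y) = x |: ((a |: (B :\ x)) :\ y) by [].
apply/setP=> v; rewrite !inE; case: (v =P x) => [->|_] /=; first by rewrite xB ?xy ?orbT.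
by case: (v =P a) => [->|] //=; rewrite andbT; apply/esym; apply: contraNneq aB => ->.
Qed.

(** Exchanging [a] out of [B - x + a - y + b] towards [B] brings in [x] or [y]; with [y] the result
    would be [B - x + b], which is not a basis. *)
Lemma double_exchange_inv B a b x y : B \in bases M ->
  a \notin B -> b \notin B -> a != b -> x \in B -> y \in B -> x != y ->
  b |: ((a |: (B :\ x)) :\ y) \in bases M -> b |: (B :\ x) \notin bases M ->
  b |: (B :\ y) \in bases M.
Proof.
move=> HB aB bB ab xB yB xy H Nbx.
have aD : a \in b |: ((a |: (B :\ x)) :\ y).
  by rewrite !inE eqxx /= andbT (_ : a != y) ?orbT //; apply: contraNneq aB => ->.
have [z [zB zD Hz]] := basis_exchange H HB aD aB.
have : z \in [set x; y].
  move: zD; rewrite !inE !negb_or zB andbT !negb_and !negb_or => /andP[_ /orP[]].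
    by rewrite negbK => ->; rewrite orbT.
  by rewrite negbK => /andP[_ ->].
rewrite !inE => /orP[] /eqP ez; rewrite ez in Hz.
  suff -> : b |: (B :\ y) = x |: ((b |: ((a |: (B :\ x)) :\ y)) :\ a) by [].
  apply/setP=> v; rewrite !inE; case: (v =P x) => [->|_] /=; first by rewrite xB ?xy ?orbT.
  case: (v =P b) => [->|] //=; first by rewrite eq_sym ab.
  case: (v =P a) => [->|] //=; by rewrite (negPf aB) andbF.
case/negP: Nbx; suff -> : b |: (B :\ x) = y |: ((b |: ((a |: (B :\ x)) :\ y)) :\ a) by [].
apply/setP=> v; rewrite !inE; case: (v =P y) => [->|_] /=; first by rewrite yB (eq_sym y x) xy
  ?orbT.
case: (v =P b) => [->|] //=; first by rewrite eq_sym ab.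
by case: (v =P a) => [->|] //=; rewrite (negPf aB) andbF.
Qed.

(* The hypothesis says that the fundamental circuit of [f] in [B] is
   contained in [f |: C], so that it is also the one in [C]. *)
Lemma exchange_transfer B C f w : B \in bases M -> C \in bases M ->
  f \notin B -> f \notin C -> w \in B -> f |: (B :\ w) \in bases M ->
  (forall u, u \in B -> f |: (B :\ u) \in bases M -> u \in C) ->
  f |: (C :\ w) \in bases M.
Proof.
move=> + HC; move: {2}_.+1 (ltnSn #|B :\: C|) => n.
elim: n B => // n IHn B lt_n HB fB fC wB Hf sub.
have [sBC|/subsetPn[x xB xC]] := boolP (B \subset C).
  by rewrite -(bases_sub_eq HB HC sBC).
have [y [yC yB Hy]] := basis_exchange HB HC xB xC.
(* Being outside [C], [x] is not on the circuit of [f]; hence the double exchanges carry the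
   hypotheses over to [B - x + y], which is closer to [C]. *)
have Nfx : f |: (B :\ x) \notin bases M by apply: contra xC; apply: sub.
have yf : y != f by apply: contraNneq fC => <-.
have wx : w != x by apply: contraNneq xC => <-; apply: sub.
have wy : w != y by apply: contraNneq yB => <-.
apply: (IHn (y |: (B :\ x))) => //.
- apply: leq_trans (_ : _ <= #|B :\: C|) _ => //; apply: proper_card; apply/properP; split.
    apply/subsetP=> z; rewrite !inE => /andP[zC /orP[/eqP zy|/andP[_ ->]]]; last by rewrite zC.
    by rewrite zy yC in zC.
  by exists x; rewrite !inE ?xB ?xC // eqxx /= orbF; apply: contraNneq yB => <-.
- by rewrite !inE negb_or eq_sym yf (negPf fB) andbF.
- by rewrite !inE wB wx orbT.
- have -> : f |: ((y |: (B :\ x)) :\ w) = y |: ((f |: (B :\ w)) :\ x).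
    apply/setP=> v; rewrite !inE; case: (v =P f) => [->|_] /=.
      by rewrite (_ : f != x) ?orbT //; apply: contraNneq fB => ->.
    case: (v =P y) => [->|_] /=; first by rewrite eq_sym wy.
    by rewrite andbCA.
  by apply: double_exchange; rewrite // eq_sym.
move=> u; rewrite !inE => /orP[/eqP->|/andP[ux uB] Hu] //.
apply: sub => //; apply: (double_exchange_inv (a := y) (x := x)) => //.
by rewrite eq_sym.
Qed.

(** Otherwise, exchanging [w] out of [B] towards the new basis would bring in [y] or [u]. This is
    how blocked sets survive moves. *)
Lemma no_exchange_mono B x y w u : B \in bases M -> x \in B -> w \in B -> x != w ->
  y |: (B :\ w) \notin bases M -> u |: (B :\ w) \notin bases M ->
  u |: ((y |: (B :\ x)) :\ w) \notin bases M.
Proof.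
move=> HB xB wB xw Ny Nu; apply/negP=> H.
have Nw z : z \notin B -> z |: (B :\ w) \in bases M -> z != y /\ z != u.
  by move=> _ Hz; split; apply: contraTneq Hz => ->.
have wN : w \notin u |: ((y |: (B :\ x)) :\ w).
  rewrite !inE eqxx orbF; apply: contraNneq Nu => <-.
  by rewrite setD1K.
have [z [zD zB Hz]] := basis_exchange HB H wB wN.
have [/negPf zy /negPf zu] := Nw _ zB Hz.
by move: zD; rewrite !inE zy zu (negPf zB) !andbF.
Qed.

End Exchange.

(** * Feasible families and levels *)

Section Walks.
Variables (T : finType) (k : nat) (M : 'I_k -> matroid T).
Local Notation family := {ffun 'I_k -> {set T}}.
Implicit Types (B C : family) (i j : 'I_k) (f w x y u : T).

Lemma feasible_basis B i : feasible M B -> B i \in bases (M i).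
Proof. by case/andP => /forallP. Qed.

Lemma feasible_disjoint B i j x : feasible M B -> x \in B i -> x \in B j -> i = j.
Proof.
move=> /andP[_ /forallP/(_ i)/forallP/(_ j)/implyP dB] xi xj; apply/eqP/negPn/negP.
by move=> /dB/pred0P/(_ x) /=; rewrite xi xj.
Qed.

Lemma feasible_ground B i x : feasible M B -> x \in B i -> x \in ground (M i).
Proof. by move=> /(@feasible_basis _ i)/bases_ground/subsetP; apply. Qed.

Definition move B i f w : family := [ffun j => if j == i then f |: (B i :\ w) else B j].
Definition arc B i f w :=
  [&& f \in ground (M i), f \notin B i, w \in B i & f |: (B i :\ w) \in bases (M i)].
Definition free B x := [forall i, x \notin B i].

Lemma freeP B x i : free B x -> x \notin B i.
Proof. by move/forallP. Qed.

Lemma feasible_move B i f w : feasible M B -> free B f -> arc B i f w -> feasible M (move B i f w).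
Proof.
move=> fB frf /and4P[_ _ _ Hb]; apply/andP; split.
  by apply/forallP => j; rewrite ffunE; case: (j =P i) => [->|_] //; apply: feasible_basis.
have mem_move j x : x \in move B i f w j -> x \in B j \/ x = f /\ j = i.
  rewrite ffunE; case: (j =P i) => [->|_]; last by left.
  by rewrite !inE => /orP[/eqP->|/andP[_ ->]]; [right|left].
apply/forallP=> j; apply/forallP=> l; apply/implyP=> /eqP njl.
apply/pred0P=> x /=; apply/negbTE/negP=> /andP[/mem_move Hj /mem_move Hl]; apply: njl.
case: Hj Hl => [xj|[-> ->]] [xl|[Ex El]] //.
- exact: feasible_disjoint fB xj xl.
- by move: xj; rewrite Ex (negPf (freeP _ frf)).
- by move: xl; rewrite (negPf (freeP _ frf)).
Qed.

Lemma adjacent_move B i f w : arc B i f w -> adjacent M B (move B i f w).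
Proof.
case/and4P=> fE fB wB _; apply/existsP; exists i; apply/andP; split.
  by apply/forallP=> j; apply/implyP=> /negPf nji; rewrite ffunE nji.
apply/existsP; exists w; rewrite wB; apply/existsP; exists f.
by rewrite inE fB fE ffunE eqxx /=.
Qed.

Lemma adjacentP B C : feasible M C -> adjacent M B C ->
  exists i x y, [/\ C = move B i y x, x \in B i, y \notin B i & y |: (B i :\ x) \in bases (M i)].
Proof.
move=> fC /existsP[i /andP[/forallP eqBC /existsP[x /andP[xB /existsP[y /andP[]]]]]].
rewrite inE => /andP[yB _] /eqP eC; exists i, x, y; split=> //.
  apply/ffunP=> j; rewrite ffunE; case: (j =P i) => [->|/eqP nji] //.
  by have /implyP/(_ nji)/eqP := eqBC j.
by rewrite -eC; apply: feasible_basis.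
Qed.

Lemma adjacent_sym B C : feasible M B -> feasible M C -> adjacent M B C -> adjacent M C B.
Proof.
move=> fB fC /(adjacentP fC)[i [x [y [-> xB yB Hy]]]].
have eB : B = move (move B i y x) i x y.
  apply/ffunP=> j; rewrite !ffunE eqxx; case: (j =P i) => [->|] //.
  apply/setP=> z; rewrite !inE; case: (z =P x) => [->|_] /=; first by rewrite xB.
  by case: (z =P y) => [->|] //=; rewrite (negPf yB).
rewrite {2}eB; apply: adjacent_move; apply/and4P; split.
- exact: feasible_ground xB.
- by rewrite ffunE eqxx !inE eqxx /= orbF; apply: contraNneq yB => <-.
- by rewrite ffunE eqxx !inE eqxx.
by have := feasible_basis i fB; rewrite {1}eB ffunE eqxx.
Qed.

Lemma walk_feasible B C s : reconfiguration_sequence M B C s -> feasible M B /\ feasible M C.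
Proof.
case: s => // B0 s /and4P[/eqP<- /eqP<- /allP fs _]; split; apply: fs; last exact: mem_last.
exact: mem_head.
Qed.

Lemma walk_cons A B C s : reconfiguration_sequence M B C s -> feasible M A -> adjacent M A B ->
  reconfiguration_sequence M A C (A :: s).
Proof.
by case: s => //= B0 s /and4P[/eqP-> -> /andP[-> ->] ->] -> ->; rewrite eqxx.
Qed.

Lemma walk_cat A B C s1 s2 : reconfiguration_sequence M A B s1 ->
  reconfiguration_sequence M B C s2 -> reconfiguration_sequence M A C (s1 ++ behead s2).
Proof.
case: s1 => //= A0 s1 /and4P[-> /eqP e1 /andP[-> f1] p1].
case: s2 => //= B0 s2 /and4P[/eqP e2 /eqP e3 /andP[_ f2] p2].
by rewrite last_cat all_cat cat_path e1 -e2 e3 eqxx f1 f2 p1 p2.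
Qed.

Lemma walk_rev A B s : reconfiguration_sequence M A B s -> reconfiguration_sequence M B A (rev s).
Proof.
elim: s A => //= A0 [|A1 s] IH A /=.
  by case/and4P=> /eqP<- /eqP<- /andP[-> _] _; rewrite !eqxx.
case/and4P=> /eqP<- /eqP eB /and3P[f0 f1 fs] /andP[adj p].
rewrite rev_cons -cats1.
apply: (@walk_cat _ A1 _ _ [:: A1; A0]).
  by apply: IH; rewrite /= !eqxx eB f1 fs p eqxx.
by rewrite /= !eqxx f0 f1 adjacent_sym.
Qed.

End Walks.

Section Levels.
Variables (T : finType) (k : nat) (M : 'I_k -> matroid T).
Local Notation family := {ffun 'I_k -> {set T}}.
Implicit Types (B C : family) (i j : 'I_k) (f w x y u : T).
Local Notation arc := (arc M).

Definition misplaced B C x := [exists i, (x \in B i) && (x \notin C i)].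
(* Level [t]: a misplaced element can be reached in at most [t] exchange arcs. *)
Fixpoint level B C t x : bool :=
  misplaced B C x ||
  (if t is t'.+1 then [exists i, exists w, arc B i x w && level B C t' w] else false).
(** The level is that of [w], so the path starting at the free element [f] has up to [t.+1] arcs. *)
Definition hit B C t := exists i f w, [/\ free B f, arc B i f w & level B C t w].
Definition no_good_arc B C :=
  forall i f w, free B f -> arc B i f w -> f \in C i -> w \in C i.
Definition dist B C := \sum_i #|B i :\: C i|.

Lemma dist_good_move B C i f w : arc B i f w -> f \in C i -> w \notin C i ->
  dist (move B i f w) C < dist B C.
Proof.
case/and4P=> _ fB wB _ fC wC; rewrite /dist (bigD1 i) //= [X in _ < X](bigD1 i) //=.
rewrite (eq_bigr (fun j => #|B j :\: C j|)); last by move=> j /negPf nji; rewrite ffunE nji.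
rewrite ltn_add2r ffunE eqxx; apply: proper_card; apply/properP; split.
  apply/subsetP=> x; rewrite !inE => /andP[xC /orP[/eqP xf|/andP[_ ->]]]; last by rewrite xC.
  by rewrite xf fC in xC.
exists w; first by rewrite !inE wC.
by rewrite !inE eqxx orbF negb_and orbC; apply/orP; left; apply: contraNneq wC => ->.
Qed.

(** [w] leaves the difference and at most [f] enters it. *)
Lemma dist_misplaced_move B C i f w : arc B i f w -> w \notin C i ->
  dist (move B i f w) C <= dist B C.
Proof.
case/and4P=> _ fB wB _ wC; rewrite /dist (bigD1 i) //= [X in _ <= X](bigD1 i) //=.
rewrite (eq_bigr (fun j => #|B j :\: C j|)); last by move=> j /negPf nji; rewrite ffunE nji.
rewrite leq_add2r ffunE eqxx (cardsD1 w (B i :\: C i)) !inE wC wB /=.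
apply: leq_trans (_ : #|f |: ((B i :\: C i) :\ w)| <= _).
  by apply: subset_leq_card; apply/subsetP=> x; rewrite !inE => /andP[-> /orP[|/andP[]] ->];
    rewrite ?orbT // => ->; rewrite orbT.
by rewrite cardsU1 leq_add2r leq_b1.
Qed.

Lemma setD_move B C i f w j : w \in C i -> f \notin B i ->
  (move B i f w) j :\: (move C i f w) j = B j :\: C j.
Proof.
move=> wC fB; rewrite !ffunE; case: (j =P i) => [->|] //.
apply/setP=> x; rewrite !inE; case: (x =P f) => [->|_] /=; first by rewrite (negPf fB) andbF.
by case: (x =P w) => [->|_] //=; rewrite wC.
Qed.

(** A free element of [B] lying in some [C i] could, by dual exchange, replace in [B i] an element
    outside [C i], along a good arc. So the union of [C] is contained in that of [B], and both have
    the same cardinality, the sum of the ranks. *)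
Lemma free_eq B C : feasible M B -> feasible M C -> no_good_arc B C ->
  forall x, free B x = free C x.
Proof.
move=> fB fC Hno.
have used_card A : feasible M A -> #|\bigcup_i A i| = \sum_i #|A i|.
  move=> fA; rewrite -!sum1_card (partition_disjoint_bigcup _ (fun=> 1)) => [|i j nij].
    by apply: eq_bigr => i _; rewrite sum1_card.
  apply/pred0P=> x /=; apply/negbTE/negP=> /andP[xi xj]; case/eqP: nij.
  exact: feasible_disjoint fA xi xj.
have sub : \bigcup_i C i \subset \bigcup_i B i.
  apply/bigcupsP=> i _; apply/subsetP=> y yC; apply/negPn/negP=> yB.
  have fry : free B y.
    by apply/forallP=> j; apply: contra yB => yj; apply/bigcupP; exists j.
  have [x [xB xC Hx]] := basis_exchange_dual (feasible_basis i fB) (feasible_basis i fC) yC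
    (freeP i fry).
  case/negP: xC; apply: (Hno i y) => //; apply/and4P; split=> //.
    exact: feasible_ground yC.
  exact: freeP.
have /eqP eBC : \bigcup_i C i == \bigcup_i B i.
  rewrite eqEcard sub !used_card // leq_eqVlt; apply/orP; left; apply/eqP.
  by apply: eq_bigr => i _; apply: (card_bases (M := M i)); apply: feasible_basis.
have freeE A x : free A x = (x \notin \bigcup_i A i).
  apply/forallP/idP => [Hx|Hx i]; first by apply/bigcupP=> -[i _]; rewrite (negPf (Hx i)).
  by apply: contra Hx => xi; apply/bigcupP; exists i.
by move=> x; rewrite !freeE eBC.
Qed.

(** By [free_eq], [w] lies in some [C j]. The move makes it free, and dual exchange brings it into
    the [j]-th basis in place of an element outside [C j]. *)
Lemma good_arc_after B C i f w : feasible M B -> feasible M C -> no_good_arc B C ->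
  free B f -> arc B i f w -> w \notin C i -> ~ no_good_arc (move B i f w) C.
Proof.
move=> fB fC Hno frf af wC Hno'.
have fB' := feasible_move fB frf af.
case/and4P: (af) => _ fBi wB _.
have wf : w != f by apply: contraNneq fBi => <-.
have /forallPn[j] : ~~ free C w.
  by rewrite -(free_eq fB fC Hno); apply/forallPn; exists i; rewrite wB.
rewrite negbK => wCj.
have frw : free (move B i f w) w.
  apply/forallP=> l; rewrite ffunE; case: (l =P i) => [_|nli].
    by rewrite !inE (negPf wf) eqxx.
  by apply/negP=> wl; apply: nli; apply: feasible_disjoint fB wl wB.
have [x [xB xC Hx]] := basis_exchange_dual (feasible_basis j fB') (feasible_basis j fC) wCj
  (freeP j frw).
case/negP: xC; apply: (Hno' j w) => //; apply/and4P; split=> //.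
  exact: feasible_ground wCj.
exact: freeP.
Qed.

(** An element outside [C i] that [f] could replace in [B i] would be misplaced and give a hit at
    level 0; so [exchange_transfer] applies. *)
Lemma arc_transfer B C i f w : feasible M B -> feasible M C -> no_good_arc B C ->
  ~ hit B C 0 -> free B f -> arc B i f w -> arc C i f w.
Proof.
move=> fB fC Hno Nh frf af; case/and4P: (af) => fE fBi wB Hw.
have placed u : u \in B i -> f |: (B i :\ u) \in bases (M i) -> u \in C i.
  move=> uB Hu; apply/negPn/negP=> uC; apply: Nh; exists i, f, u; split=> //.
    by apply/and4P; split.
  by rewrite /= orbF; apply/existsP; exists i; rewrite uB.
have fCi : f \notin C i by apply: freeP; rewrite -(free_eq fB fC Hno).
apply/and4P; split=> //; first exact: placed.
apply: (exchange_transfer (feasible_basis i fB)) => //; exact: feasible_basis.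
Qed.

Lemma level_mono B C s t x : s <= t -> level B C s x -> level B C t x.
Proof.
elim: t s x => [|t IH] [|s] x //=; first by rewrite orbF => _ ->.
move=> le_st /orP[->//|/existsP[i /existsP[w /andP[a lw]]]].
by apply/orP; right; apply/existsP; exists i; apply/existsP; exists w; rewrite a (IH s).
Qed.

(* A free element seeing no element of level [s] cannot destroy, when it is
   exchanged for [w], the arcs leading to level [s]. *)
Lemma arc_after B C i f w s j x u : feasible M B -> free B f -> arc B i f w ->
  ~ hit B C s -> level B C s u -> arc B j x u -> arc (move B i f w) j x u.
Proof.
move=> fB frf af Nh lu ax; case/and4P: (af) => _ fBi wB Hw; case/and4P: (ax) => xE xB uB Hx.
have Nfu : ~ arc B j f u by move=> a; apply: Nh; exists j, f, u.
case: (j =P i) => [ej|/eqP/negPf nji]; last by apply/and4P; rewrite ffunE nji.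
subst j.
have xf : x != f by apply: contra_notN Nfu => /eqP <-.
have uw : u != w by apply: contra_notN Nfu => /eqP ->.
have uf : u != f by apply: contraNneq fBi => <-.
have xw : x != w by apply: contraNneq xB => ->.
apply/and4P; rewrite ffunE eqxx; split=> //.
- by rewrite !inE (negPf xf) (negPf xB) andbF.
- by rewrite !inE uB uw orbT.
apply: double_exchange => //.
- exact: feasible_basis.
- by rewrite eq_sym.
- by rewrite eq_sym.
- by apply/negP=> H; apply: Nfu; apply/and4P; split=> //; case/and4P: af.
Qed.

(** [w] is not misplaced, so it has an arc to some [u] of level [t], and the move makes [w] free.
    Changing both families alike leaves the misplaced elements the same, and [arc_after] preserves
    the arcs into levels up to [t]. *)
Lemma hit_after B C t i f w : feasible M B -> feasible M C -> no_good_arc B C ->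
  (forall s, s <= t -> ~ hit B C s) -> free B f -> arc B i f w -> level B C t.+1 w -> w \in C i ->
  hit (move B i f w) (move C i f w) t.
Proof.
move=> fB fC Hno Nh frf af lw wC.
case/and4P: (af) => _ fBi wB _.
have misE x : misplaced (move B i f w) (move C i f w) x = misplaced B C x.
  apply: eq_existsb => j; have := setD_move j wC fBi.
  by move/setP/(_ x); rewrite !inE andbC [in RHS]andbC.
have levelS s x : s <= t -> level B C s x -> level (move B i f w) (move C i f w) s x.
  elim: s x => [|s IH] x le_st; rewrite /= misE //.
  move=> /orP[mx|/existsP[j /existsP[u /andP[a lu]]]]; first by rewrite mx.
  apply/orP; right; apply/existsP; exists j; apply/existsP; exists u.
  by rewrite (IH _ _ lu) ?(ltnW le_st) // andbT; apply: arc_after (Nh _ (ltnW le_st)) lu a.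
have Nmis : ~~ misplaced B C w.
  by apply/existsPn=> j; apply/negP=> /andP[wj]; rewrite (feasible_disjoint fB wj wB) wC.
move: lw; rewrite /= (negPf Nmis) => /existsP[j /existsP[u /andP[a lu]]].
exists j, w, u; split; last exact: levelS.
  apply/forallP=> l; rewrite ffunE; case: (l =P i) => [_|nli].
    by rewrite !inE eqxx orbF; apply: contraNneq fBi => <-.
  by apply/negP=> wl; apply: nli; apply: feasible_disjoint fB wl wB.
exact: arc_after (Nh _ (leqnn t)) lu a.
Qed.

(** * Blocked sets, which certify that a family cannot be reached *)

Definition blocked (V : {set T}) B :=
  (forall i x u, x \in V -> x \in B i -> u \notin B i -> u \notin V ->
     u |: (B i :\ x) \notin bases (M i)) /\
  (forall x, x \in V -> exists i, x \in B i).

(** The entering [y] is outside [V], whose elements are all in use, so the leaving [x] is outside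
    [V] too. Exchanges for an element of [V] that were impossible stay so by [no_exchange_mono]. *)
Lemma blocked_adjacent (V : {set T}) B C : feasible M B -> feasible M C -> blocked V B ->
  adjacent M B C -> blocked V C /\ forall i, B i :&: V = C i :&: V.
Proof.
move=> fB fC [bB cB] /(adjacentP fC)[i [x [y [eC xB yB Hy]]]].
have yV : y \notin V.
  apply/negP=> /cB[j yj]; case/negP: yB.
  have yC l : y \in B l \/ l = i -> y \in C l.
    by rewrite eC ffunE; case: (l =P i) => [_ _|n [|//]] //; rewrite !inE eqxx.
  by rewrite (feasible_disjoint fC (yC i (or_intror erefl)) (yC j (or_introl yj))).
have xV : x \notin V by apply/negP=> xV; case/negP: (bB i x y xV xB yB yV).
have eV j : B j :&: V = C j :&: V.
  rewrite eC ffunE; case: (j =P i) => [->|] //; apply/setP=> z; rewrite !inE.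
  case: (z =P x) => [->|_] /=; first by rewrite (negPf xV) !andbF.
  by case: (z =P y) => [->|] //=; rewrite (negPf yV) !andbF.
split=> //; split=> [j z u zV|z zV]; last first.
  by have [j zj] := cB z zV; exists j; have /setP/(_ z) := eV j; rewrite !inE zj zV !andbT => <-.
move=> zC uC uV; have zB : z \in B j by have /setP/(_ z) := eV j; rewrite !inE zC zV !andbT.
move: zC uC; rewrite eC ffunE; case: (j =P i) => [ej|_]; last by move=> _ uB; apply: bB.
subst j => _; have xz : x != z by apply: contraNneq xV => ->.
rewrite !inE negb_or negb_and negbK => /andP[uy uxB].
have Ny : y |: (B i :\ z) \notin bases (M i) by apply: bB.
(* Only [x] is new outside the changed basis, and putting it back for [z] amounts to exchanging [z]
   for [y] in [B i]. *)
case/orP: uxB => [/eqP->|uB].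
  suff -> : x |: ((y |: (B i :\ x)) :\ z) = y |: (B i :\ z) by [].
  apply/setP=> v; rewrite !inE; case: (v =P x) => [->|_] /=; first by rewrite xB xz orbT.
  by case: (v =P y) => [->|] //=; rewrite andbT; apply: contraNneq yV => ->.
by apply: no_exchange_mono => //; [exact: feasible_basis | apply: bB].
Qed.

Lemma blocked_walk (V : {set T}) B C s : blocked V B -> reconfiguration_sequence M B C s ->
  forall i, B i :&: V = C i :&: V.
Proof.
elim: s B => //= A [|A1 s] IH B bB /=; first by case/and4P=> /eqP<- /eqP<-.
case/and4P=> /eqP eA /eqP eC /and3P[fA fA1 fs] /andP[adj p] i; subst A.
have [bA1 ->] := blocked_adjacent fA fA1 bB adj.
by apply: (IH A1 bA1); rewrite /= eqxx eC eqxx fA1 fs p.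
Qed.

(** The levels increase inside a set of at most [n] elements, so some level [t <= n] equals the
    next; it serves as [V]. A free element in it would not be misplaced, hence would have an arc
    into the level before, that is, a hit. *)
Lemma stuck_blocked B C n : feasible M B ->
  #|\bigcup_i ground (M i)| <= n -> (forall t, t <= n -> ~ hit B C t) ->
  exists2 V, blocked V B & forall x, misplaced B C x -> x \in V.
Proof.
move=> fB le_n Nh; pose L t := [set x | level B C t x].
have L_sub t : L t \subset \bigcup_i ground (M i).
  apply/subsetP=> x; rewrite inE.
  have mis : misplaced B C x -> x \in \bigcup_i ground (M i).
    by case/existsP=> i /andP[xi _]; apply/bigcupP; exists i => //; apply: feasible_ground xi.
  case: t => [|t] /= /orP[/mis|] //.
  by case/existsP=> i /existsP[w /andP[/and4P[xE _ _ _] _]]; apply/bigcupP; exists i.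
have [t le_t Lt] : exists2 t, t <= n & L t.+1 \subset L t.
  have [/existsP[t Lt]|/existsPn H] := boolP [exists t : 'I_n.+1, L t.+1 \subset L t].
    by exists t => //; rewrite -ltnS.
  have card_L t : t <= n.+1 -> t <= #|L t|.
    elim: t => // t IH lt_t; apply: leq_ltn_trans (IH (ltnW lt_t)) _.
    apply: proper_card; rewrite properE (H (Ordinal lt_t)) andbT.
    by apply/subsetP=> x; rewrite !inE; apply: level_mono.
  have := leq_trans (card_L _ (leqnn _)) (subset_leq_card (L_sub _)).
  by rewrite ltnNge le_n.
exists (L t) => [|x mx]; last by rewrite inE; apply: level_mono (leq0n t) _; rewrite /= mx.
split=> [i x u|x].
  rewrite !inE => lx xB uB; apply: contra => Hu.
  have : u \in L t.+1.
    rewrite inE /=; apply/orP; right; apply/existsP; exists i; apply/existsP; exists x.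
    rewrite lx andbT; apply/and4P; split=> //.
    by apply: (subsetP (bases_ground Hu)); rewrite !inE eqxx.
  by move/(subsetP Lt); rewrite inE.
rewrite inE => lx.
have [/existsP[i xi]|] := boolP [exists i, x \in B i]; first by exists i.
rewrite negb_exists => frx; exfalso.
have Nmis : ~~ misplaced B C x by apply/existsPn=> i; rewrite negb_and (forallP frx).
case: t le_t lx {Lt} => [|t] le_t /=; rewrite (negPf Nmis) //=.
case/existsP=> i /existsP[w /andP[a lw]].
by apply: (Nh t (ltnW le_t)); exists i, x, w.
Qed.

Lemma dist0_eq B C : feasible M B -> feasible M C -> (forall x, ~~ misplaced B C x) -> B = C.
Proof.
move=> fB fC H; apply/ffunP=> i; apply: (bases_sub_eq (M := M i)); try exact: feasible_basis.
apply/subsetP=> x xB; apply/negPn/negP=> xC; case/existsP: (H x); exists i.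
by rewrite xB.
Qed.

End Levels.

(** * Costs of evaluation *)

(** A weighted count of nodes: a call or a query counts one for its own step and one for the at most
    [K] units spent by the callee or the oracle. *)
Fixpoint expr_size (e : expr) : nat :=
  match e with
  | EVar _ | ENil => 1
  | EPair e1 e2 | EEqElt e1 e2 | ELet e1 e2 | EQuery e1 e2 => (expr_size e1 + expr_size e2).+2
  | EFst e1 | ESnd e1 => (expr_size e1).+1
  | EIf e1 e2 e3 => (expr_size e1 + expr_size e2 + expr_size e3).+1
  | ECall _ es => (foldr (fun e n => expr_size e + n) 0 es).+2
  end.

Fixpoint simple (e : expr) : bool :=
  match e with
  | EVar _ | ENil => true
  | EPair e1 e2 | EEqElt e1 e2 => simple e1 && simple e2
  | EFst e1 | ESnd e1 => simple e1
  | _ => false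
  end.

(** The last case is the value of [ENil], and a default for the expressions that are not
    [simple]. *)
Fixpoint simple_value (T : eqType) (rho : seq (value T)) (e : expr) : value T :=
  match e with
  | EVar n => nth Defs.Nil rho n
  | EPair e1 e2 => Pair (simple_value rho e1) (simple_value rho e2)
  | EFst e1 => vfst (simple_value rho e1)
  | ESnd e1 => vsnd (simple_value rho e1)
  | EEqElt e1 e2 => vbool T (veqelt (simple_value rho e1) (simple_value rho e2))
  | _ => Defs.Nil
  end.

(* [loop f n base body] is the body of the function of index [f] folding from
   the right over its first argument, with [n] constant further arguments. In
   [body], index 0 is the result on the tail, index 1 the whole list, and
   indices 2, 3, ... are the further arguments. *)
Definition loop_head := EFst (EVar 1).
Definition loop (f n : nat) (base body : expr) : expr :=
  EIf (EVar 0)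
      (ELet (ECall f (ESnd (EVar 0) :: [seq EVar i | i <- iota 1 n])) body) base.

Section Cost.
Variables (T : eqType) (orc : oracle T) (P : program).

(* [K] bounds the cost of a single call or query. Without recursion every node
   of [e] is visited at most once, whence the bound [expr_size e * K]. *)
Definition evaluates (K : nat) rho e (v : value T) :=
  exists2 t, t <= expr_size e * K & eval orc P rho e v t.
Definition computes (K f : nat) args (v : value T) :=
  exists2 t, t <= K & eval orc P args (nth ENil P f) v t.

Lemma evaluates_simple K rho e : 0 < K -> simple e -> evaluates K rho e (simple_value rho e).
Proof.
move=> K0; elim: e => //=.
- by move=> n _; exists 1; [rewrite mul1n | constructor].
- by move=> _; exists 1; [rewrite mul1n | constructor].
- move=> e1 IH1 e2 IH2 /andP[/IH1[t1 l1 H1] /IH2[t2 l2 H2]].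
  exists (t1 + t2).+1; last by constructor.
  by rewrite mulSn -addn1 addnC leq_add // mulSn mulnDl; apply: leq_trans (leq_addl _ _);
    apply: leq_add.
- by move=> e IH /IH[t l H]; exists t.+1; [rewrite mulSn -add1n leq_add | constructor].
- by move=> e IH /IH[t l H]; exists t.+1; [rewrite mulSn -add1n leq_add | constructor].
- move=> e1 IH1 e2 IH2 /andP[/IH1[t1 l1 H1] /IH2[t2 l2 H2]].
  exists (t1 + t2).+1; last by constructor.
  by rewrite mulSn -addn1 addnC leq_add // mulSn mulnDl; apply: leq_trans (leq_addl _ _);
    apply: leq_add.
Qed.

Lemma evaluates_ret K rho e v : 0 < K -> simple e -> simple_value rho e = v -> evaluates K rho e v.
Proof. by move=> K0 se <-; apply: evaluates_simple. Qed.

Lemma evaluates_if K rho c e1 e2 v : 0 < K -> simple c ->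
  (vtrue (simple_value rho c) -> evaluates K rho e1 v) -> (~~ vtrue (simple_value rho c) ->
    evaluates K rho e2 v) ->
  evaluates K rho (EIf c e1 e2) v.
Proof.
move=> K0 sc H1 H2; have [t lt Ht] := evaluates_simple rho K0 sc.
have [u lu Hu] : exists2 u, u <= (expr_size e1 + expr_size e2) * K &
    eval orc P rho (if vtrue (simple_value rho c) then e1 else e2) v u.
  rewrite mulnDl; case: ifP => [/H1|/negbT/H2] [u lu Hu]; exists u => //.
  - exact: leq_trans lu (leq_addr _ _).
  - exact: leq_trans lu (leq_addl _ _).
exists (t + u).+1; last exact: eval_if Ht Hu.
by rewrite /= mulSn -addnA mulnDl -add1n leq_add // leq_add.
Qed.

Lemma evaluates_let K rho e1 e2 w v : 0 < K -> evaluates K rho e1 w -> evaluates K (w :: rho) e2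
  v ->
  evaluates K rho (ELet e1 e2) v.
Proof.
move=> K0 [t lt Ht] [u lu Hu]; exists (t + u).+1; last exact: eval_let Ht Hu.
by rewrite /= mulSn -add1n leq_add // mulSn mulnDl; apply: leq_trans (leq_addl _ _); apply: leq_add.
Qed.

Lemma evaluates_evals K rho es : 0 < K -> all simple es ->
  exists2 t, t <= foldr (fun e n => expr_size e + n) 0 es * K &
    evals orc P rho es [seq simple_value rho e | e <- es] t.
Proof.
move=> K0; elim: es => [|e es IH] /=; first by exists 0 => //; constructor.
move=> /andP[se /IH[u lu Hu]]; have [t lt Ht] := evaluates_simple rho K0 se.
by exists (t + u); [rewrite mulnDl leq_add | constructor].
Qed.

Lemma evaluates_call K rho f es v : 0 < K -> all simple es ->
  computes K f [seq simple_value rho e | e <- es] v -> evaluates K rho (ECall f es) v.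
Proof.
move=> K0 ses [u lu Hu]; have [t lt Ht] := evaluates_evals rho K0 ses.
exists (t + u).+1; last exact: eval_call Ht Hu.
by rewrite /= !mulSn addnA (addnC t) -addSn leq_add // -add1n leq_add.
Qed.

Lemma evaluates_query K rho e1 e2 i s b c : 0 < K -> simple e1 -> simple e2 ->
  simple_value rho e1 = vnat T i -> simple_value rho e2 = velts s -> orc i s = Some (b, c) ->
  size s + c <= K -> evaluates K rho (EQuery e1 e2) (vbool T b).
Proof.
move=> K0 /(evaluates_simple rho K0)[t lt Ht] /(evaluates_simple rho K0)[u lu Hu] e_i e_s Ho le_c.
rewrite e_i in Ht; rewrite e_s in Hu.
exists (t + u + size s + c).+1; last exact: eval_query Ht Hu Ho.
rewrite /= !mulSn mulnDl; lia.
Qed.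

Lemma computes_le K K' f args v : K <= K' -> computes K f args v -> computes K' f args v.
Proof. by move=> le_K [t lt Ht]; exists t => //; apply: leq_trans le_K. Qed.

Lemma computes_body K K' f args v : expr_size (nth ENil P f) * K <= K' ->
  evaluates K args (nth ENil P f) v -> computes K' f args v.
Proof. by move=> le_K [t lt Ht]; exists t => //; apply: leq_trans le_K. Qed.

(** [res] gives the result on each suffix. The body is examined only at suffixes of the actual list
    [s], so that its analysis may use that [x] belongs to [s]. *)
Lemma computes_loop K K' m f n base body X (enc : X -> value T) ctx (res : seq X -> value T) s :
  0 < K ->
  nth ENil P f = loop f n base body -> size ctx = n -> size s <= m ->
  m.+1 * (expr_size (loop f n base body) * K) <= K' ->
  evaluates K (Defs.Nil :: ctx) base (res [::]) ->
  (forall p x s', s = p ++ x :: s' ->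
     evaluates K [:: res s', vlist [seq enc y | y <- x :: s'] & ctx] body (res (x :: s'))) ->
  computes K' f (vlist [seq enc y | y <- s] :: ctx) (res s).
Proof.
move=> K0 Ef sz_ctx sz_s leK Hbase Hbody.
(* With the length of [s] in place of its bound [m], the claim can be proved by induction on [s]. *)
apply: (@computes_le ((size s).+1 * (expr_size (loop f n base body) * K))).
  by apply: leq_trans leK; rewrite leq_mul2r ltnS sz_s orbT.
elim: s {sz_s} Hbody => [|x s IH] Hbody.
  apply: (@computes_body K); first by rewrite Ef mul1n.
  by rewrite Ef; apply: evaluates_if.
have {IH} [t lt Ht] : computes ((size s).+1 * (expr_size (loop f n base body) * K)) f
    (vlist [seq enc y | y <- s] :: ctx) (res s).
  by apply: IH => p y s' Es; apply: (Hbody (x :: p)); rewrite Es.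
have [u lu Hu] := Hbody [::] x s erefl.
pose args := ESnd (EVar 0) :: [seq EVar i | i <- iota 1 n].
pose rho := vlist [seq enc y | y <- x :: s] :: ctx.
have sargs : all simple args by rewrite /args /= all_map; apply/allP.
have [w lw Hw] := evaluates_evals rho K0 sargs.
have dargs : [seq simple_value rho e | e <- args] = vlist [seq enc y | y <- s] :: ctx.
  rewrite /args /=; congr (_ :: _); apply: (@eq_from_nth _ Defs.Nil).
    by rewrite !size_map size_iota.
  rewrite !size_map size_iota => k lt_k.
  by rewrite (nth_map ENil) ?size_map ?size_iota // (nth_map 0) ?size_iota // nth_iota.
rewrite dargs in Hw.
(* One unit for the tested variable, [w] for the arguments, [t] for the recursive call, [u] for the
   body, and one for each of the call, the binding and the branch. *)
exists (1 + ((w + t).+1 + u).+1).+1; last first.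
  rewrite Ef; apply: (@eval_if _ _ _ _ _ _ _ (vlist [seq enc y | y <- x :: s]) _ _ _);
    first exact: eval_var.
  by rewrite /=; apply: eval_let Hu; apply: eval_call Hw _; rewrite -/(nth ENil P f).
rewrite [size _]/= mulSn; move: lt; set b := _.+1 * _ => lt.
set S0 := expr_size _.
have -> : S0 = (1 + ((foldr (fun e n => expr_size e + n) 0 args).+2 + expr_size body).+2 +
  expr_size base).+1 by [].
move: (foldr _ _ _) lw => c lw; move: (expr_size body) (expr_size base) lu => c1 c2 lu;
  clearbody b; rewrite !(mulSn, mulnDl); lia.
Qed.

End Cost.

(** * The program *)

Local Notation V := EVar.
Local Notation F := EFst.
Local Notation S := ESnd.

Definition etrue := EPair ENil ENil.

(* The functions called by a main function, which has index 0. Families are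
   stored as lists of slots ((i, E_i), (B_i, C_i)), an arc as (slot, (f, w)),
   and a state as (slots, (hist1, hist2)), the latest family coming first in
   the histories. *)
Definition common : program := [::
  (* 1: mem (l, x) *)
  loop 1 1 ENil (EIf (EEqElt loop_head (V 2)) etrue (V 0));
  (* 2: remf (l, w) *)
  loop 2 1 ENil (EIf (EEqElt loop_head (V 2)) (V 0) (EPair loop_head (V 0)));
  (* 3: cat (l, m) *)
  loop 3 1 (V 1) (EPair loop_head (V 0));
  (* 4: flatten l *)
  loop 4 0 ENil (ECall 3 [:: loop_head; V 0]);
  (* 5, 6: projections on B and C *)
  loop 5 0 ENil (EPair (F (S loop_head)) (V 0));
  loop 6 0 ENil (EPair (S (S loop_head)) (V 0));
  (* 7: arcs_from (l, slot, f, acc) *)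
  loop 7 3 (V 3)
    (ELet (ECall 2 [:: F (S (V 2)); F (V 1)])
    (ELet (EQuery (F (F (V 3))) (EPair (V 4) (V 0)))
    (EIf (V 0) (EPair (EPair (V 4) (EPair (V 5) (F (V 3)))) (V 2)) (V 2))));
  (* 8: slot_arcs (l, slot) *)
  loop 8 1 ENil
    (ELet (ECall 1 [:: F (S (V 2)); loop_head])
    (EIf (V 0) (V 1) (ECall 7 [:: F (S (V 3)); V 3; F (V 2); V 1])));
  (* 9: arcs slots *)
  loop 9 0 ENil (ELet (ECall 8 [:: S (F loop_head); loop_head]) (ECall 3 [:: V 0; V 1]));
  (* 10: good_arcs (arcs, used) *)
  loop 10 1 ENil
    (ELet (ECall 1 [:: V 2; F (S loop_head)])
    (EIf (V 0) (V 1)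
    (ELet (ECall 1 [:: S (S (F (F (V 2)))); F (S (F (V 2)))])
    (EIf (V 0)
      (ELet (ECall 1 [:: S (S (F (F (V 3)))); S (S (F (V 3)))])
      (EIf (V 0) (V 3) (EPair (F (V 4)) (V 3))))
      (V 2)))));
  (* 11: hits (arcs, used, W) *)
  loop 11 2 ENil
    (ELet (ECall 1 [:: V 2; F (S loop_head)])
    (EIf (V 0) (V 1)
    (ELet (ECall 1 [:: V 4; S (S (F (V 2)))])
    (EIf (V 0) (EPair (F (V 3)) (V 2)) (V 2)))));
  (* 12: expand (arcs, W, W0) *)
  loop 12 2 (V 2)
    (ELet (ECall 1 [:: V 2; S (S loop_head)])
    (EIf (V 0) (EPair (F (S (F (V 2)))) (V 1)) (V 1)));
  (* 13: slot_wrong (l, C, acc) *)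
  loop 13 2 (V 2)
    (ELet (ECall 1 [:: V 2; loop_head]) (EIf (V 0) (V 1) (EPair (F (V 2)) (V 1))));
  (* 14: wrong slots *)
  loop 14 0 ENil (ECall 13 [:: F (S loop_head); S (S loop_head); V 0]);
  (* 15: bfs (fuel, arcs, used, W0) *)
  loop 15 3 (ELet (ECall 11 [:: V 1; V 2; V 3]) (EPair (V 0) (V 4)))
    (EIf (F (V 0)) (V 0)
    (ELet (ECall 12 [:: V 2; S (V 0); V 4])
    (ELet (ECall 11 [:: V 3; V 4; V 0]) (EPair (V 0) (V 1)))));
  (* 16, 17: replace w by f in the list B, resp. C, containing it *)
  loop 16 2 ENil
    (ELet (ECall 1 [:: F (S loop_head); V 3])
    (EIf (V 0)
      (ELet (ECall 2 [:: F (S (F (V 2))); V 4])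
      (EPair (EPair (F (F (V 3))) (EPair (EPair (V 4) (V 0)) (S (S (F (V 3)))))) (V 2)))
      (EPair (F (V 2)) (V 1))));
  loop 17 2 ENil
    (ELet (ECall 1 [:: S (S loop_head); V 3])
    (EIf (V 0)
      (ELet (ECall 2 [:: S (S (F (V 2))); V 4])
      (EPair (EPair (F (F (V 3))) (EPair (F (S (F (V 3)))) (EPair (V 4) (V 0)))) (V 2)))
      (EPair (F (V 2)) (V 1))));
  (* 18: step (state, fuel) *)
  ELet (ECall 5 [:: F (V 0)])
  (ELet (ECall 4 [:: V 0])
  (ELet (ECall 9 [:: F (V 2)])
  (ELet (ECall 10 [:: V 0; V 1])
  (EIf (V 0) (ECall 19 [:: V 4; F (V 0)])
  (ELet (ECall 14 [:: F (V 4)])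
  (ELet (ECall 15 [:: V 6; V 2; V 3; V 0])
  (EIf (F (V 0))
    (ELet (ECall 1 [:: S (S (F (F (F (V 0))))); S (S (F (F (V 0))))])
    (EIf (V 0) (ECall 20 [:: V 7; F (F (V 1))]) (ECall 19 [:: V 7; F (F (V 1))])))
    (V 6))))))));
  (* 19: move1 (state, arc) *)
  ELet (ECall 16 [:: F (V 0); F (S (V 1)); S (S (V 1))])
  (ELet (ECall 5 [:: V 0])
  (EPair (V 1) (EPair (EPair (V 0) (F (S (V 2)))) (S (S (V 2))))));
  (* 20: move2 (state, arc) *)
  ELet (ECall 19 [:: V 0; V 1])
  (ELet (ECall 17 [:: F (V 0); F (S (V 2)); S (S (V 2))])
  (ELet (ECall 6 [:: V 0])
  (EPair (V 1) (EPair (F (S (V 2))) (EPair (V 0) (S (S (V 2))))))));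
  (* 21, 22: nested iterations (fuel, fuel, state) *)
  loop 21 2 (V 2) (ECall 18 [:: V 0; V 2]);
  loop 22 2 (V 2) (ECall 21 [:: V 2; V 2; V 0]);
  (* 23: init (lE, lB, lC, i) *)
  EIf (V 0)
    (ELet (ECall 23 [:: S (V 0); S (V 1); S (V 2); EPair ENil (V 3)])
    (EPair (EPair (EPair (V 4) (F (V 1))) (EPair (F (V 2)) (F (V 3)))) (V 0)))
    ENil;
  (* 24: rev l *)
  loop 24 0 ENil (ECall 3 [:: V 0; EPair loop_head ENil]);
  (* 25: solve (lE, lB, lC) *)
  ELet (ECall 4 [:: V 0])
  (ELet (ECall 23 [:: V 1; V 2; V 3; ENil])
  (ELet (EPair ENil (EPair ENil (V 1)))
  (ELet (ECall 22 [:: V 0; V 0; EPair (V 1) (EPair (EPair (V 4) ENil) (EPair (V 5) ENil))])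
  (ELet (ECall 14 [:: F (V 0)])
  (EIf (V 0) ENil
  (ELet (ECall 24 [:: F (S (V 1))]) (ECall 3 [:: V 0; S (S (S (V 2)))])))))))
].

(** * The algorithm as a function on lists *)

Definition remf (T : eqType) (w : T) s := [seq x <- s | x != w].
Definition upd (T : eqType) (f w : T) s := if w \in s then f :: remf w s else s.

Section Algo.
Variables (T : eqType) (k : nat) (bas : 'I_k -> seq T -> bool) (E : 'I_k -> seq T).
Implicit Types B C : 'I_k -> seq T.
Local Notation arc := ('I_k * (T * T))%type.

Definition arcs_from B i f s : seq arc :=
  [seq (i, (f, w)) | w <- s & bas i (f :: remf w (B i))].
Definition slot_arcs B i s :=
  flatten [seq if f \in B i then [::] else arcs_from B i f (B i) | f <- s].
Definition arcs_of B s := flatten [seq slot_arcs B i (E i) | i <- s].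
Definition arcs B := arcs_of B (enum 'I_k).
Definition used B := flatten [seq B i | i <- enum 'I_k].
Definition good_arcs B C : seq arc :=
  [seq a <- arcs B | (a.2.1 \notin used B) && ((a.2.1 \in C a.1) && (a.2.2 \notin C a.1))].
Definition hits B (W : seq T) : seq arc :=
  [seq a <- arcs B | (a.2.1 \notin used B) && (a.2.2 \in W)].
Definition wrong B C := flatten [seq [seq x <- B i | x \notin C i] | i <- enum 'I_k].
Definition expand B C (W : seq T) := [seq a.2.1 | a <- arcs B & a.2.2 \in W] ++ wrong B C.
(** Once some level is hit, further rounds return it unchanged: the hits are those at the first
    possible level, which makes the paths shortest. *)
Fixpoint bfs B C n :=
  if n is n'.+1 then
    let r := bfs B C n' in
    if nilp r.1 then let W := expand B C r.2 in (hits B W, W) else r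
  else (hits B (wrong B C), wrong B C).

(** The basis to change is recognized as the one containing [w], which is unique in a feasible
    family; see [repl_at]. *)
Definition repl (a : arc) B : 'I_k -> seq T := fun i => upd a.2.1 a.2.2 (B i).

Record state := State {
  cur : 'I_k -> seq T; tgt : 'I_k -> seq T;
  hist1 : seq ('I_k -> seq T); hist2 : seq ('I_k -> seq T) }.

Definition move1 st a :=
  let B := repl a (cur st) in State B (tgt st) (B :: hist1 st) (hist2 st).
Definition move2 st a :=
  let B := repl a (cur st) in let C := repl a (tgt st) in
  State B C (B :: hist1 st) (C :: hist2 st).

Definition step n st :=
  let B := cur st in let C := tgt st in
  if good_arcs B C is a :: _ then move1 st a
  else if (bfs B C n).1 is a :: _ then
    (if a.2.2 \in C a.1 then move2 st a else move1 st a)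
  else st.

(** Let [D] be the total size of the ground sets. The search needs depth at least [D]; with depth
    [D + 2], at most [D * (D + 4)] steps lead to a stuck state, and this is at most the square of
    [D + 2]. *)
Definition fuel := (size (flatten [seq E i | i <- enum 'I_k])).+2.
Definition init_state B C := State B C [:: B] [:: C].
Definition final B C := iter (fuel * fuel) (step fuel) (init_state B C).
(** The first history, reversed, leads from the source to the common family, and the second one from
    there to the target; the common family is kept once. A reconfiguration sequence is never empty,
    so the empty list can stand for a negative answer. *)
Definition solution st :=
  if nilp (wrong (cur st) (tgt st)) then rev (hist1 st) ++ behead (hist2 st) else [::].

Definition vfam B : value T := vlist [seq velts (B i) | i <- enum 'I_k].
Definition slot B C (i : 'I_k) : value T :=
  Pair (Pair (vnat T i) (velts (E i))) (Pair (velts (B i)) (velts (C i))).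
Definition vslots B C := vlist [seq slot B C i | i <- enum 'I_k].
Definition varc B C (a : arc) : value T :=
  Pair (slot B C a.1) (Pair (Elt a.2.1) (Elt a.2.2)).
Definition vstate st : value T :=
  Pair (vslots (cur st) (tgt st))
    (Pair (vlist [seq vfam B | B <- hist1 st]) (vlist [seq vfam B | B <- hist2 st])).

End Algo.

(** * The program computes the algorithm within the time bounds *)

Section Run.
Variables (T : eqType) (k : nat) (bas : 'I_k -> seq T -> bool) (E : 'I_k -> seq T).
Variables (orc : oracle T) (main : expr) (N m : nat).
Local Notation P := (main :: common).
Hypothesis kN : k <= N.
Hypothesis EN : forall i, size (E i) <= N.
(** [m] bounds the lengths of all lists and the time of a query. At most [N ^ 3] arcs,
    [N ^ 3 + N ^ 2] entries of a search level and [(N + 2) ^ 2 + 1] families of a history fit in. *)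
Hypothesis mN : (N + 3) ^ 3 <= m.
Hypothesis orcP : forall (i : 'I_k) s, {subset s <= E i} -> size s <= N.+1 ->
  exists2 c, size s + c <= m & orc i s = Some (bas i s, c).

Definition wf (B : 'I_k -> seq T) := forall i, uniq (B i) /\ {subset B i <= E i}.

(* [cost j] bounds the time of functions whose calls are nested [j] deep: a
   loop runs at most [m] times a body of [expr_size] at most 200. *)
Definition cost j := (m.+1 * 200) ^ j.+1.
Local Notation computes := (computes orc P).
Local Notation evaluates := (evaluates orc P).

Lemma cost_gt0 j : 0 < cost j. Proof. by rewrite expn_gt0. Qed.
Lemma leq_cost i j : i <= j -> cost i <= cost j. Proof. by move=> le_ij; rewrite leq_pexp2l. Qed.
Lemma leq_cost0 j : m <= cost j.
Proof. by apply: leq_trans (leq_cost (leq0n j)); rewrite /cost expn1; lia. Qed.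

Lemma computes_cost_le i j f args v : computes (cost i) f args v -> i <= j -> computes (cost j) f
  args v.
Proof. by move=> H /leq_cost le_ij; apply: computes_le H. Qed.

Lemma computes_loop_cost j f n base body X (enc : X -> value T) ctx (res : seq X -> value T) s :
  nth ENil P f = loop f n base body -> size ctx = n -> size s <= m ->
  expr_size (loop f n base body) <= 200 ->
  evaluates (cost j) (Defs.Nil :: ctx) base (res [::]) ->
  (forall p x s', s = p ++ x :: s' ->
     evaluates (cost j) [:: res s', vlist [seq enc y | y <- x :: s'] & ctx] body (res (x :: s'))) ->
  computes (cost j.+1) f (vlist [seq enc y | y <- s] :: ctx) (res s).
Proof.
move=> Ef szc szs le_sz Hb Hs; apply: computes_loop Ef szc szs _ Hb Hs; first exact: cost_gt0.
by rewrite mulnA /cost (expnS _ j.+1) leq_mul2r leq_mul2l le_sz orbT orbT.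
Qed.

Ltac ret := apply: evaluates_ret; [exact: cost_gt0 | by [] | rewrite /=].
Ltac eif := apply: evaluates_if; [exact: cost_gt0 | by [] | rewrite /= | rewrite /=].
Ltac tcall := apply: evaluates_call; [exact: cost_gt0 | by [] | rewrite /=].
Ltac lcall := eapply evaluates_let; [exact: cost_gt0 | tcall | ].

Lemma vtrue_vbool b : vtrue (vbool T b) = b. Proof. by case: b. Qed.

Lemma computes_mem s x : size s <= m -> computes (cost 1) 1 [:: velts s; Elt x] (vbool T (x \in s)).
Proof.
move=> szs; apply: (computes_loop_cost (res := fun s => vbool T (x \in s))) => //; first by ret.
move=> p y s' _; eif; rewrite vtrue_vbool => e.
  by ret; rewrite inE eq_sym e.
by ret; rewrite inE eq_sym (negPf e).
Qed.

Lemma computes_remf s w : size s <= m -> computes (cost 1) 2 [:: velts s; Elt w] (velts (remf w s)).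
Proof.
move=> szs; apply: (computes_loop_cost (res := fun s => velts (remf w s))) => //; first by ret.
move=> p y s' _; eif; rewrite vtrue_vbool => e.
  by ret; rewrite e.
by ret; rewrite e.
Qed.

Lemma computes_cat X (enc : X -> value T) s t : size s <= m ->
  computes (cost 1) 3 [:: vlist [seq enc x | x <- s]; vlist [seq enc x | x <- t]]
    (vlist [seq enc x | x <- s ++ t]).
Proof.
move=> szs; apply: (computes_loop_cost (res := fun s => vlist [seq enc x | x <- s ++ t])) => //;
  first by ret.
by move=> p y s' _; ret.
Qed.

Lemma computes_flatten X (g : X -> seq T) s : size s <= m -> (forall x, size (g x) <= m) ->
  computes (cost 2) 4 [:: vlist [seq velts (g x) | x <- s]] (velts (flatten [seq g x | x <- s])).
Proof.
move=> szs szg; apply: (computes_loop_cost (res := fun s => velts (flatten [seq g x | x <- s])))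
  => //; first by ret.
by move=> p y s' _; tcall; apply: computes_cat.
Qed.

Lemma size_enum_k : size (enum 'I_k) <= m.
Proof. by rewrite size_enum_ord (leq_trans kN) // (leq_trans _ mN) // !expnS; nia. Qed.

Lemma computes_proj1 B C : computes (cost 1) 5 [:: vslots E B C] (vfam B).
Proof.
apply: (computes_loop_cost (res := fun s => vlist [seq velts (B i) | i <- s])) => //.
- exact: size_enum_k.
- by ret.
by move=> p i s' _; ret.
Qed.

Lemma computes_proj2 B C : computes (cost 1) 6 [:: vslots E B C] (vfam C).
Proof.
apply: (computes_loop_cost (res := fun s => vlist [seq velts (C i) | i <- s])) => //.
- exact: size_enum_k.
- by ret.
by move=> p i s' _; ret.
Qed.

Lemma wf_size B i : wf B -> size (B i) <= N.
Proof. by move=> /(_ i)[uB sB]; apply: leq_trans (EN i); apply: uniq_leq_size. Qed.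

Lemma leN : N <= m.
Proof. by apply: leq_trans mN; rewrite !expnS; nia. Qed.

Lemma computes_arcs_from B C i f s acc : wf B -> f \in E i -> {subset s <= B i} -> size s <= N ->
  computes (cost 2) 7 [:: velts s; slot E B C i; Elt f; vlist [seq varc E B C a | a <- acc]]
    (vlist [seq varc E B C a | a <- arcs_from bas B i f s ++ acc]).
Proof.
move=> wB fE sB szs.
apply: (computes_loop_cost (res := fun s => vlist [seq varc E B C a | a <- arcs_from bas B i f s
  ++ acc])) => //.
- exact: leq_trans leN.
- by ret.
move=> p w s' _; lcall; first by apply: computes_remf; apply: leq_trans leN; apply: wf_size.
have sz : size (f :: remf w (B i)) <= N.+1.
  by rewrite /= ltnS size_filter (leq_trans (count_size _ _)) // wf_size.
(* Queries outside the ground set are illegal; this one is legal because [f] is taken from [E i]. *)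
have sub : {subset f :: remf w (B i) <= E i}.
  move=> x; rewrite inE => /orP[/eqP->//|]; rewrite mem_filter => /andP[_].
  by case: (wB i) => _; apply.
have [c cm Ho] := orcP sub sz.
eapply evaluates_let; first exact: cost_gt0.
  eapply evaluates_query; [exact: cost_gt0 | by [] | by [] | reflexivity | | exact: Ho | ].
    by [].
  exact: leq_trans (leq_cost0 _).
by eif; rewrite vtrue_vbool => e; ret; rewrite /arcs_from /= ?e ?(negPf e).
Qed.

Lemma computes_slot_arcs B C i : wf B ->
  computes (cost 3) 8 [:: velts (E i); slot E B C i]
    (vlist [seq varc E B C a | a <- slot_arcs bas B i (E i)]).
Proof.
move=> wB.
apply: (computes_loop_cost (res := fun s => vlist [seq varc E B C a | a <- slot_arcs bas B i s]))
  => //.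
- exact: leq_trans leN.
- by ret.
move=> p f s' eE; lcall.
  by apply: computes_cost_le (computes_mem _ _) _; rewrite // (leq_trans (wf_size i wB)) // leN.
eif; rewrite vtrue_vbool => e; first by ret; rewrite /slot_arcs /= e.
tcall; rewrite /slot_arcs /= (negPf e); apply: computes_arcs_from => //; last exact: wf_size.
(* The decomposition of [E i] supplied by the loop rule shows that [f] belongs to it. *)
by rewrite eE mem_cat inE eqxx orbT.
Qed.

Lemma size_arcs_from B i f s : size (arcs_from bas B i f s) <= size s.
Proof. by rewrite size_map size_filter count_size. Qed.

Lemma size_flatten_le (X Y : Type) (g : X -> seq Y) n s : (forall x, size (g x) <= n) ->
  size (flatten [seq g x | x <- s]) <= size s * n.
Proof. by move=> le_n; elim: s => //= x s IH; rewrite size_cat mulSn leq_add. Qed.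

Lemma size_slot_arcs B i : wf B -> size (slot_arcs bas B i (E i)) <= N * N.
Proof.
move=> wB; apply: leq_trans (_ : size (E i) * N <= _); last by rewrite leq_mul2r EN orbT.
apply: size_flatten_le => f; case: ifP => // _.
exact: leq_trans (size_arcs_from _ _ _ _) (wf_size i wB).
Qed.

Lemma size_arcs B : wf B -> size (arcs bas E B) <= N * (N * N).
Proof.
move=> wB; apply: leq_trans (_ : size (enum 'I_k) * (N * N) <= _).
  by apply: size_flatten_le => i; apply: size_slot_arcs.
by rewrite size_enum_ord leq_mul2r kN orbT.
Qed.

Lemma size_arcs_m B : wf B -> size (arcs bas E B) <= m.
Proof. by move/size_arcs; move/leq_trans; apply; apply: leq_trans mN; rewrite !expnS; nia. Qed.

Lemma computes_arcs B C : wf B ->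
  computes (cost 4) 9 [:: vslots E B C] (vlist [seq varc E B C a | a <- arcs bas E B]).
Proof.
move=> wB.
apply: (computes_loop_cost (res := fun s => vlist [seq varc E B C a | a <- arcs_of bas E B s]))
  => //.
- exact: size_enum_k.
- by ret.
move=> p i s' _; lcall; first by apply: computes_slot_arcs.
rewrite /arcs_of /=; tcall; apply: computes_cost_le (computes_cat _ _ _) _ => //.
apply: leq_trans (size_slot_arcs _ wB) _; apply: leq_trans mN; rewrite !expnS; nia.
Qed.

Lemma size_used B : wf B -> size (used B) <= m.
Proof.
move=> wB; apply: leq_trans (size_flatten_le _ (fun i => wf_size i wB)) _.
apply: leq_trans mN; rewrite size_enum_ord !expnS; nia.
Qed.

Lemma computes_used B : wf B -> computes (cost 2) 4 [:: vfam B] (velts (used B)).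
Proof.
move=> wB; apply: computes_flatten; first exact: size_enum_k.
by move=> i; apply: leq_trans leN; apply: wf_size.
Qed.

Lemma computes_good_arcs B C : wf B -> wf C ->
  computes (cost 2) 10 [:: vlist [seq varc E B C a | a <- arcs bas E B]; velts (used B)]
    (vlist [seq varc E B C a | a <- good_arcs bas E B C]).
Proof.
move=> wB wC.
pose Q (a : 'I_k * (T * T)) := (a.2.1 \notin used B) && ((a.2.1 \in C a.1) && (a.2.2 \notin C a.1)).
apply: (computes_loop_cost (res := fun s => vlist [seq varc E B C a | a <- s & Q a])) => //.
- exact: size_arcs_m.
- by ret.
have szC i : size (C i) <= m by apply: leq_trans leN; apply: wf_size.
move=> p a s' _; lcall; first by apply: computes_mem; apply: size_used.
eif; rewrite vtrue_vbool => e1; first by ret; rewrite [Q a]/Q e1.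
lcall; first exact: computes_mem.
eif; rewrite vtrue_vbool => e2; last by ret; rewrite [Q a]/Q (negPf e2) andbF.
lcall; first exact: computes_mem.
by eif; rewrite vtrue_vbool => e3; ret; rewrite [Q a]/Q (negPf e1) e2 ?e3 ?(negPf e3).
Qed.

Lemma computes_hits B C W : wf B -> size W <= m ->
  computes (cost 2) 11 [:: vlist [seq varc E B C a | a <- arcs bas E B]; velts (used B); velts W]
    (vlist [seq varc E B C a | a <- hits bas E B W]).
Proof.
move=> wB szW.
pose Q (a : 'I_k * (T * T)) := (a.2.1 \notin used B) && (a.2.2 \in W).
apply: (computes_loop_cost (res := fun s => vlist [seq varc E B C a | a <- s & Q a])) => //.
- exact: size_arcs_m.
- by ret.
move=> p a s' _; lcall; first by apply: computes_mem; apply: size_used.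
eif; rewrite vtrue_vbool => e1; first by ret; rewrite [Q a]/Q e1.
lcall; first exact: computes_mem.
by eif; rewrite vtrue_vbool => e2; ret; rewrite [Q a]/Q (negPf e1) ?e2 ?(negPf e2).
Qed.

Lemma computes_expand B C W : wf B -> size W <= m ->
  computes (cost 2) 12 [:: vlist [seq varc E B C a | a <- arcs bas E B]; velts W; velts (wrong B C)]
    (velts (expand bas E B C W)).
Proof.
move=> wB szW.
apply: (computes_loop_cost (res := fun s => velts ([seq a.2.1 | a <- s & a.2.2 \in W] ++ wrong B
  C))) => //.
- exact: size_arcs_m.
- by ret.
move=> p a s' _; lcall; first exact: computes_mem.
by eif; rewrite vtrue_vbool => e; ret; rewrite ?e ?(negPf e).
Qed.

Lemma computes_slot_wrong s t acc : size s <= m -> size t <= m ->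
  computes (cost 2) 13 [:: velts s; velts t; velts acc] (velts ([seq x <- s | x \notin t] ++ acc)).
Proof.
move=> szs szt.
apply: (computes_loop_cost (res := fun s => velts ([seq x <- s | x \notin t] ++ acc))) => //;
  first by ret.
move=> p x s' _; lcall; first exact: computes_mem.
by eif; rewrite vtrue_vbool => e; ret; rewrite ?e ?(negPf e).
Qed.

Lemma computes_wrong B C : wf B -> wf C -> computes (cost 3) 14 [:: vslots E B C] (velts (wrong B
  C)).
Proof.
move=> wB wC.
apply: (computes_loop_cost (res := fun s => velts (flatten [seq [seq x <- B i | x \notin C i] | i
  <- s]))) => //.
- exact: size_enum_k.
- by ret.
by move=> p i s' _; tcall; apply: computes_slot_wrong; apply: leq_trans leN; apply: wf_size.
Qed.

Lemma size_wrong B C : wf B -> size (wrong B C) <= N * N.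
Proof.
move=> wB; apply: leq_trans (_ : size (enum 'I_k) * N <= _).
  apply: size_flatten_le => i; rewrite size_filter (leq_trans (count_size _ _)) //.
  exact: wf_size.
by rewrite size_enum_ord leq_mul2r kN orbT.
Qed.

(** The lists may have repetitions, but they do not grow with the depth: [expand] rebuilds a level
    from the arcs and the misplaced elements instead of appending to the previous one. *)
Lemma size_bfs B C n : wf B -> size (bfs bas E B C n).2 <= m.
Proof.
move=> wB; have le_m : N * (N * N) + N * N <= m by apply: leq_trans mN; rewrite !expnS; nia.
elim: n => [|n IH] /=.
  by apply: leq_trans (size_wrong C wB) _; apply: leq_trans le_m; apply: leq_addl.
case: ifP => // _; rewrite size_cat (leq_trans _ le_m) // leq_add ?size_wrong // size_map
  size_filter.
by apply: leq_trans (count_size _ _) (size_arcs wB).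
Qed.

Lemma vtrue_vlist (X : Type) (enc : X -> value T) s : vtrue (vlist [seq enc x | x <- s]) = ~~
  nilp s.
Proof. by case: s. Qed.

Lemma computes_bfs B C s : wf B -> size s <= m ->
  computes (cost 3) 15 [:: vlist s; vlist [seq varc E B C a | a <- arcs bas E B];
                  velts (used B); velts (wrong B C)]
    (Pair (vlist [seq varc E B C a | a <- (bfs bas E B C (size s)).1])
          (velts (bfs bas E B C (size s)).2)).
Proof.
(* The fuel is a list of arbitrary values of which only the length matters; the identity serves as
   encoding in the loop rule. *)
move=> wB szs; rewrite -{1}[s]map_id.
apply: (computes_loop_cost (res := fun s => let r := bfs bas E B C (size s) in
  Pair (vlist [seq varc E B C a | a <- r.1]) (velts r.2))) => //.
  lcall; last by ret.
  by apply: computes_hits => //; apply: (size_bfs C 0).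
move=> p x s' _; cbv zeta; eif; rewrite vtrue_vlist => e; first by ret; rewrite (negPf e).
rewrite negbK in e.
lcall; first by apply: computes_expand => //; apply: size_bfs.
lcall; first by apply: computes_hits => //; have := size_bfs C (size s').+1 wB; rewrite /= e.
by ret; rewrite e.
Qed.

Lemma computes_repl1 B C a : wf B ->
  computes (cost 2) 16 [:: vslots E B C; Elt a.2.1; Elt a.2.2] (vslots E (repl a B) C).
Proof.
move=> wB.
apply: (computes_loop_cost (res := fun s => vlist [seq slot E (repl a B) C i | i <- s])) => //.
- exact: size_enum_k.
- by ret.
have szB i : size (B i) <= m by apply: leq_trans leN; apply: wf_size.
move=> p i s' _; lcall; first exact: computes_mem.
eif; rewrite vtrue_vbool => e; last first.
  by ret; rewrite (_ : slot E (repl a B) C i = slot E B C i) // /slot /repl /upd (negPf e).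
lcall; first exact: computes_remf.
by ret; congr Pair; rewrite /slot /repl /upd e.
Qed.

Lemma computes_repl2 B C a : wf C ->
  computes (cost 2) 17 [:: vslots E B C; Elt a.2.1; Elt a.2.2] (vslots E B (repl a C)).
Proof.
move=> wC.
apply: (computes_loop_cost (res := fun s => vlist [seq slot E B (repl a C) i | i <- s])) => //.
- exact: size_enum_k.
- by ret.
have szC i : size (C i) <= m by apply: leq_trans leN; apply: wf_size.
move=> p i s' _; lcall; first exact: computes_mem.
eif; rewrite vtrue_vbool => e; last first.
  by ret; rewrite (_ : slot E B (repl a C) i = slot E B C i) // /slot /repl /upd (negPf e).
lcall; first exact: computes_remf.
by ret; congr Pair; rewrite /slot /repl /upd e.
Qed.


Lemma computes_body_cost i f args v : expr_size (nth ENil P f) <= 200 ->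
  evaluates (cost i) args (nth ENil P f) v -> computes (cost i.+1) f args v.
Proof.
move=> le_sz; apply: computes_body; rewrite /cost (expnS _ i.+1) leq_mul2r.
by rewrite (leq_trans le_sz) ?orbT //; lia.
Qed.

Local Notation step := (step bas E).
Local Notation vstate := (vstate E).

Lemma computes_move1 st a : wf (cur st) ->
  computes (cost 3) 19 [:: vstate st; varc E (cur st) (tgt st) a] (vstate (move1 st a)).
Proof.
move=> wB; apply: computes_body_cost => //.
lcall; first by apply: computes_repl1.
lcall; first by apply: computes_cost_le (computes_proj1 _ _) _.
by ret.
Qed.

Lemma computes_move2 st a : wf (cur st) -> wf (tgt st) ->
  computes (cost 4) 20 [:: vstate st; varc E (cur st) (tgt st) a] (vstate (move2 st a)).
Proof.
move=> wB wC; apply: computes_body_cost => //.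
lcall; first by apply: computes_move1.
lcall; first by apply: computes_cost_le (computes_repl2 _ _ _) _.
lcall; first by apply: computes_cost_le (computes_proj2 _ _) _.
by ret.
Qed.

Lemma computes_step st s : wf (cur st) -> wf (tgt st) -> size s <= m ->
  computes (cost 5) 18 [:: vstate st; vlist s] (vstate (step (size s) st)).
Proof.
move=> wB wC szs; apply: computes_body_cost => //.
lcall; first by apply: computes_cost_le (computes_proj1 _ _) _.
lcall; first by apply: computes_cost_le (computes_used _) _.
lcall; first by apply: computes_cost_le (computes_arcs _ _) _.
lcall; first by apply: computes_cost_le (computes_good_arcs _ _) _.
rewrite /step; eif.
  case: (good_arcs _ _ _ _) => // a l _.
  by tcall; apply: computes_cost_le (computes_move1 _ _) _.
case: (good_arcs _ _ _ _) => // _.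
lcall; first by apply: computes_cost_le (computes_wrong _ _) _.
lcall; first by apply: computes_cost_le (computes_bfs _ _ _) _.
case: (bfs _ _ _ _ _).1 => [|a l]; eif=> // _; first by ret.
lcall.
  by apply: computes_cost_le (computes_mem _ _) _ => //; apply: leq_trans leN; apply: wf_size.
eif; rewrite vtrue_vbool => e; rewrite ?e ?(negPf e).
  by tcall; apply: computes_cost_le (computes_move2 _ _ _) _.
by tcall; apply: computes_cost_le (computes_move1 _ _) _.
Qed.

Lemma computes_iter st s s0 : size s <= m -> size s0 <= m ->
  (forall j, j <= size s -> wf (cur (iter j (step (size s0)) st)) /\
                            wf (tgt (iter j (step (size s0)) st))) ->
  computes (cost 6) 21 [:: vlist s; vlist s0; vstate st] (vstate (iter (size s) (step (size s0))
    st)).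
Proof.
move=> szs szs0 wfs; rewrite -{1}[s]map_id.
apply: (computes_loop_cost (res := fun s => vstate (iter (size s) (step (size s0)) st))) => //;
  first by ret.
move=> p x s' es; have [] := wfs (size s').
  by rewrite es size_cat /=; lia.
by move=> wB wC; tcall; apply: computes_step.
Qed.

Lemma computes_iter2 st s0 : size s0 <= m ->
  (forall j, wf (cur (iter j (step (size s0)) st)) /\ wf (tgt (iter j (step (size s0)) st))) ->
  computes (cost 7) 22 [:: vlist s0; vlist s0; vstate st]
    (vstate (iter (size s0 * size s0) (step (size s0)) st)).
Proof.
move=> szs0 wfs; rewrite -{1}[s0]map_id.
apply: (computes_loop_cost (res := fun s => vstate (iter (size s * size s0) (step (size s0))
  st))) => //.
  by ret.
move=> p x s' es; tcall; rewrite mulSn iterD; apply: computes_iter => // j _.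
by rewrite -iterD.
Qed.

(** This function descends three lists at once while counting up an index, so it is not a [loop],
    and its time is counted by hand: at most 100 units for each slot. *)
Lemma computes_init_aux B C s i : [seq val j | j <- s] = iota i (size s) ->
  computes ((size s).+1 * 100) 23
    [:: vlist [seq velts (E i) | i <- s]; vlist [seq velts (B i) | i <- s];
        vlist [seq velts (C i) | i <- s]; vnat T i]
    (vlist [seq slot E B C i | i <- s]).
Proof.
elim: s i => [|j s IH] i /=.
  move=> _; apply: (computes_body (K := 1)) => //.
  by apply: evaluates_if => //= _; apply: evaluates_ret.
case=> ei /IH[t lt Ht].
pose rho := [:: vlist [seq velts (E i) | i <- j :: s]; vlist [seq velts (B i) | i <- j :: s];
                vlist [seq velts (C i) | i <- j :: s]; vnat T i].
have [w lw Hw] := @evaluates_evals _ orc P 1 rho [:: S (V 0); S (V 1); S (V 2);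
  EPair ENil (V 3)] isT isT.
have [u lu Hu] := @evaluates_simple _ orc P 1 (vlist [seq slot E B C i | i <- s] :: rho)
  (EPair (EPair (EPair (V 4) (F (V 1))) (EPair (F (V 2)) (F (V 3)))) (V 0)) isT isT.
exists (1 + ((w + t).+1 + u).+1).+1; last first.
  rewrite /slot ei; apply: (@eval_if _ _ _ _ _ _ _ (nth Defs.Nil rho 0)); first exact: eval_var.
  by rewrite /=; apply: eval_let Hu; apply: eval_call Hw Ht.
by move: lw lu lt => /=; lia.
Qed.

Lemma computes_init B C :
  computes (cost 1) 23 [:: vfam E; vfam B; vfam C; Defs.Nil] (vslots E B C).
Proof.
apply: computes_le (computes_init_aux (i := 0) _ _ _); last by rewrite val_enum_ord size_enum_ord.
have := size_enum_k; set n := size _ => le_n.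
apply: leq_trans (leq_cost (leq0n 1)); rewrite /cost expn1; lia.
Qed.

Lemma computes_rev X (enc : X -> value T) s : size s <= m ->
  computes (cost 2) 24 [:: vlist [seq enc x | x <- s]] (vlist [seq enc x | x <- rev s]).
Proof.
move=> szs; apply: (computes_loop_cost (res := fun s => vlist [seq enc x | x <- rev s])) => //;
  first by ret.
move=> p x s' es; tcall; rewrite rev_cons -cats1.
apply: (computes_cat enc [:: x]).
by rewrite size_rev (leq_trans _ szs) // es size_cat /=; lia.
Qed.

Lemma computes_solve B C : fuel E <= m ->
  (forall j, let st := iter j (step (fuel E)) (init_state B C) in wf (cur st) /\ wf (tgt st)) ->
  size (hist1 (final bas E B C)) <= m ->
  computes (cost 8) 25 [:: vfam E; vfam B; vfam C]
    (vlist [seq vfam B | B <- solution (final bas E B C)]).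
Proof.
move=> le_fuel wfs sz_hist; apply: computes_body_cost => //.
have szE i : size (E i) <= m by apply: leq_trans (EN i) leN.
lcall; first by apply: computes_cost_le (computes_flatten size_enum_k szE) _.
lcall; first by apply: computes_cost_le (computes_init _ _) _.
eapply evaluates_let; [exact: cost_gt0 | apply: evaluates_simple;
  [exact: cost_gt0 | by []] | rewrite /=].
set s0 := flatten _.
(* The two leading entries, added by the program in front of the concatenated ground sets, account
   for the [.+2] in [fuel]. *)
pose s := [:: Defs.Nil, Defs.Nil & [seq Elt x | x <- s0]].
have size_s : size s = fuel E by rewrite /= size_map.
lcall; first by apply: (computes_iter2 (s0 := s) (st := init_state B C)); rewrite size_s.
rewrite size_s -/(final bas E B C).
have [wB wC] := wfs (fuel E * fuel E).
lcall; first by apply: computes_cost_le (computes_wrong _ _) _.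
rewrite /solution; eif; rewrite vtrue_vlist => e.
  by ret; rewrite (negPf e).
rewrite negbK in e; rewrite e.
lcall; first by apply: computes_cost_le (computes_rev _ _) _.
tcall.
(* The second component of [Nil] is [Nil], in agreement with [behead] on the empty list. *)
case: (hist2 _) => [|C' l] /=; first by apply: computes_cost_le (computes_cat _ [::] _) _;
  rewrite ?size_rev.
by apply: computes_cost_le (computes_cat _ _ _) _; rewrite ?size_rev.
Qed.

End Run.

(** * Correctness of the algorithm *)

Section Correctness.
Variables (T : finType) (k : nat) (M : 'I_k -> matroid T) (E : 'I_k -> seq T).
Hypothesis E_ground : forall i, E i =i ground (M i).
Implicit Types (B C : 'I_k -> seq T).
Local Notation bas := (fun i s => [set x in s] \in bases (M i)).

Definition fam B : {ffun 'I_k -> {set T}} := [ffun i => [set x in B i]].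

Lemma in_fam B i x : (x \in fam B i) = (x \in B i).
Proof. by rewrite ffunE inE. Qed.

Lemma set_remf f w (s : seq T) : [set x in f :: remf w s] = f |: ([set x in s] :\ w).
Proof. by apply/setP=> x; rewrite !inE mem_filter. Qed.

Lemma mem_arcs B a : (a \in arcs bas E B) = arc M (fam B) a.1 a.2.1 a.2.2.
Proof.
rewrite /arc !in_fam -E_ground; apply/flatten_mapP/and4P => [[i _ /flatten_mapP[f fE]]|[fE fB wB
  Hb]].
  case: ifP => // /negbT fB /mapP[w]; rewrite mem_filter => /andP[Hb wB] -> /=.
  by split=> //; rewrite ffunE -set_remf.
exists a.1; first exact: mem_enum.
apply/flatten_mapP; exists a.2.1 => //; rewrite (negPf fB).
apply/mapP; exists a.2.2; last by case: a {fE fB wB Hb} => i [f w].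
by rewrite mem_filter wB andbT set_remf; rewrite ffunE in Hb.
Qed.

Lemma notin_used B x : (x \notin used B) = free (fam B) x.
Proof.
apply/negP/forallP => [H i|H /flatten_mapP[i _ xi]].
  by rewrite in_fam; apply/negP=> xi; apply/H/flatten_mapP; exists i; rewrite ?mem_enum.
by have := H i; rewrite in_fam xi.
Qed.

Lemma mem_wrong B C x : (x \in wrong B C) = misplaced (fam B) (fam C) x.
Proof.
apply/flatten_mapP/existsP => [[i _]|[i]].
  by rewrite mem_filter => /andP[xC xB]; exists i; rewrite !in_fam xB.
by rewrite !in_fam => /andP[xB xC]; exists i; rewrite ?mem_enum // mem_filter xC.
Qed.

Fixpoint levels B C t : seq T :=
  if t is t'.+1 then expand bas E B C (levels B C t') else wrong B C.

Lemma mem_levels B C t x : (x \in levels B C t) = level M (fam B) (fam C) t x.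
Proof.
elim: t x => [|t IH] x /=; first by rewrite mem_wrong orbF.
rewrite mem_cat mem_wrong orbC; congr orb; apply/mapP/existsP => [[a]|[i /existsP[w /andP[ax lw]]]].
  rewrite mem_filter mem_arcs IH => /andP[lw ax] ->; exists a.1.
  by apply/existsP; exists a.2.2; rewrite ax.
by exists (i, (x, w)); rewrite // mem_filter mem_arcs IH lw.
Qed.

Lemma mem_hits B C t a : (a \in hits bas E B (levels B C t)) =
  [&& free (fam B) a.2.1, arc M (fam B) a.1 a.2.1 a.2.2 & level M (fam B) (fam C) t a.2.2].
Proof. by rewrite mem_filter notin_used mem_levels mem_arcs -andbA [X in _ && X]andbC. Qed.

Lemma hitP B C t : reflect (hit M (fam B) (fam C) t) (~~ nilp (hits bas E B (levels B C t))).
Proof.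
apply: (iffP idP) => [|[i [f [w [frf a lw]]]]].
  case Eh: (hits _ _ _ _) => [//|a l] _; have := mem_head a l; rewrite -Eh mem_hits.
  by case/and3P=> *; exists a.1, a.2.1, a.2.2.
have: (i, (f, w)) \in hits bas E B (levels B C t) by rewrite mem_hits frf a lw.
by case: (hits _ _ _ _).
Qed.

(** The absence of hits below the level found is what [arc_transfer] and [hit_after] require. *)
Lemma bfsP B C n :
  (bfs bas E B C n = ([::], levels B C n) /\
     forall t, t <= n -> ~ hit M (fam B) (fam C) t) \/
  (exists t, [/\ t <= n, (bfs bas E B C n).1 = hits bas E B (levels B C t),
     hit M (fam B) (fam C) t & forall s, s < t -> ~ hit M (fam B) (fam C) s]).
Proof.
elim: n => [|n [[eB Nh]|[t [le_t eB Ht Nh]]]].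
- case: (hitP B C 0) => [H|Nh]; [right|left]; first by exists 0.
  have /nilP /= -> : nilp (hits bas E B (levels B C 0)) by apply/negPn/negP=> /hitP.
  by split=> // -[].
- rewrite /= eB /=; case: (hitP B C n.+1) => [H|Nh1]; [right|left].
    by exists n.+1; split=> // s lt_s; apply: Nh.
  have /nilP /= -> : nilp (hits bas E B (levels B C n.+1)) by apply/negPn/negP=> /hitP.
  split=> // t.
  by rewrite leq_eqVlt => /orP[/eqP->|/Nh].
right; exists t; rewrite (leqW le_t) /= eB; split=> //.
by move/hitP: (Ht); case: (nilp _).
Qed.

Lemma no_good_arcP B C : reflect (no_good_arc M (fam B) (fam C)) (nilp (good_arcs bas E B C)).
Proof.
have memE a : (a \in good_arcs bas E B C) =
    [&& free (fam B) a.2.1, arc M (fam B) a.1 a.2.1 a.2.2, a.2.1 \in C a.1 & a.2.2 \notin C a.1].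
  rewrite mem_filter notin_used mem_arcs -andbA; by congr andb; rewrite andbC.
apply: (iffP nilP) => [e i f w frf a fC|H].
  apply/negPn/negP=> wC; have := memE (i, (f, w)).
  by rewrite e /= frf a -!in_fam fC wC.
case Eg: good_arcs => [//|a l]; have := mem_head a l; rewrite -Eg memE => /and4P[frf ax fC].
by rewrite -in_fam (H _ _ _ frf ax) ?in_fam.
Qed.

Local Notation wf := (wf E).
Local Notation walk := (reconfiguration_sequence M).

Lemma repl_at B i f w j : feasible M (fam B) -> w \in B i ->
  repl (i, (f, w)) B j = if j == i then f :: remf w (B i) else B j.
Proof.
move=> fB wB; rewrite /repl /upd /=; case: (j =P i) => [->|nji]; first by rewrite wB.
case: ifP => // wj; case: nji.
by apply: (feasible_disjoint (x := w) fB); rewrite in_fam.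
Qed.

Lemma fam_repl B i f w : feasible M (fam B) -> w \in B i ->
  fam (repl (i, (f, w)) B) = move (fam B) i f w.
Proof.
move=> fB wB; apply/ffunP=> j; rewrite ffunE repl_at // ffunE; case: (j =P i) => [_|_].
  by rewrite set_remf ffunE.
by rewrite ffunE.
Qed.

Lemma wf_repl B i f w : wf B -> feasible M (fam B) -> arc M (fam B) i f w ->
  wf (repl (i, (f, w)) B).
Proof.
move=> wB fB /and4P[fE fBi wBi _] j; rewrite !in_fam in fBi wBi.
rewrite repl_at //; case: (j =P i) => [->|_]; last exact: wB.
have [uB sB] := wB i; split.
  by rewrite /= filter_uniq // mem_filter (negPf fBi) andbF.
move=> x; rewrite inE => /orP[/eqP->|]; first by rewrite E_ground.
by rewrite mem_filter => /andP[_ /sB].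
Qed.

Variables S0 T0 : {ffun 'I_k -> {set T}}.

(** As moves are reversible, a history with the latest family first is itself a reconfiguration
    sequence back to the given family. *)
Definition inv (st : state T k) :=
  [/\ wf (cur st), wf (tgt st), walk (fam (cur st)) S0 (map fam (hist1 st)) &
      walk (fam (tgt st)) T0 (map fam (hist2 st))].

Lemma inv_feasible st : inv st -> feasible M (fam (cur st)) /\ feasible M (fam (tgt st)).
Proof. by case=> _ _ /walk_feasible[? _] /walk_feasible[]. Qed.

Lemma walk_repl B (A : {ffun 'I_k -> {set T}}) (H : seq ('I_k -> seq T)) i f w : walk (fam B) A
  (map fam H) ->
  free (fam B) f -> arc M (fam B) i f w ->
  walk (fam (repl (i, (f, w)) B)) A (map fam (repl (i, (f, w)) B :: H)).
Proof.
move=> wk frf a; have [fB _] := walk_feasible wk.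
have wB : w \in B i by rewrite -in_fam; case/and4P: a.
have fB' := feasible_move fB frf a.
rewrite map_cons fam_repl //.
exact: (walk_cons wk fB' (adjacent_sym fB fB' (adjacent_move a))).
Qed.

Lemma inv_move1 st i f w : inv st -> free (fam (cur st)) f -> arc M (fam (cur st)) i f w ->
  inv (move1 st (i, (f, w))).
Proof.
move=> Hst frf a; have [fB _] := inv_feasible Hst; case: Hst => wB wC wk1 wk2.
by split=> //; [apply: wf_repl | apply: walk_repl].
Qed.

Lemma inv_move2 st i f w : inv st -> free (fam (cur st)) f -> arc M (fam (cur st)) i f w ->
  free (fam (tgt st)) f -> arc M (fam (tgt st)) i f w ->
  inv (move2 st (i, (f, w))).
Proof.
move=> Hst frf a frf' a'; have [fB fC] := inv_feasible Hst; case: Hst => wB wC wk1 wk2.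
by split=> //; try apply: wf_repl; try apply: walk_repl.
Qed.

(** * Progress and termination *)

Definition stuck n st := no_good_arc M (fam (cur st)) (fam (tgt st)) /\
  forall t, t <= n -> ~ hit M (fam (cur st)) (fam (tgt st)) t.
Definition sdist st := dist (fam (cur st)) (fam (tgt st)).

(* The potential of a state is its distance together with the first level at
   which a free element hits. *)
Variant step_spec n st (st' : state T k) : Prop :=
| StepGood of inv st' & sdist st' < sdist st
| StepMisplaced of inv st' & sdist st' <= sdist st &
    ~ no_good_arc M (fam (cur st')) (fam (tgt st'))
| StepPlaced t of no_good_arc M (fam (cur st)) (fam (tgt st)) &
    forall s, s <= t -> ~ hit M (fam (cur st)) (fam (tgt st)) s &
    t < n & inv st' & sdist st' = sdist st & hit M (fam (cur st')) (fam (tgt st')) t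
| StepStuck of stuck n st & st' = st.

Lemma stepP n st : inv st -> step_spec n st (step bas E n st).
Proof.
move=> Hst; have [fB fC] := inv_feasible Hst; rewrite /step.
have := no_good_arcP (cur st) (tgt st).
case Eg: (good_arcs _ _ _ _) => [|a l] /= Hno; last first.
  clear Hno; have : a \in good_arcs bas E (cur st) (tgt st) by rewrite Eg mem_head.
  rewrite mem_filter notin_used mem_arcs -!in_fam; case: a {Eg} => i [f w] /= /andP[].
  case/andP=> frf /andP[f_C w_C] a.
  apply: StepGood; first exact: inv_move1.
  rewrite /sdist /= fam_repl //; last by rewrite -in_fam; case/and4P: a.
  exact: (dist_good_move a).
have {}Hno : no_good_arc M (fam (cur st)) (fam (tgt st)) by apply/Hno.
have [[-> Nh]|[t [le_t -> Ht Nh]]] := bfsP (cur st) (tgt st) n; first exact: StepStuck.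
case Eh: (hits _ _ _ _) => [|[i [f w]] l]; first by move/hitP: Ht; rewrite Eh.
have : (i, (f, w)) \in hits bas E (cur st) (levels (cur st) (tgt st) t) by rewrite Eh mem_head.
rewrite mem_hits => /and3P[/= frf a lw].
have wB : w \in cur st i by rewrite -in_fam; case/and4P: a.
case: ifPn => wC; last first.
  apply: StepMisplaced; first exact: inv_move1.
    by rewrite /sdist /= fam_repl //; apply: (dist_misplaced_move a); rewrite ?in_fam.
  by rewrite /= fam_repl //; apply: (good_arc_after fB fC Hno frf a); rewrite ?in_fam.
have wC' : w \in fam (tgt st) i by rewrite in_fam.
have Nmis : ~~ misplaced (fam (cur st)) (fam (tgt st)) w.
  apply/existsPn=> j; apply/negP=> /andP[wj].
  by rewrite -in_fam in wB; rewrite (feasible_disjoint fB wj wB) wC'.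
(* Level 0 consists of misplaced elements, so a target lying in [C i] is first hit at a successor
   level. *)
case: t le_t Ht Nh lw {Eh} => [|t] le_t Ht Nh lw; first by rewrite /= orbF (negPf Nmis) in lw.
have frf' : free (fam (tgt st)) f by rewrite -(free_eq fB fC Hno).
have a' : arc M (fam (tgt st)) i f w by apply: (arc_transfer fB fC Hno) => //; apply: Nh.
apply: (@StepPlaced _ _ _ t) => //=.
- exact: inv_move2.
- rewrite /sdist /= !fam_repl //; apply: eq_bigr => j _; rewrite setD_move //.
  exact: freeP.
by rewrite !fam_repl //; apply: hit_after.
Qed.

Lemma inv_step n st : inv st -> inv (step bas E n st).
Proof. by move=> Hst; case: (stepP n Hst) => // _ ->. Qed.

Lemma inv_iter n st j : inv st -> inv (iter j (step bas E n) st).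
Proof. by move=> Hst; elim: j => //= j; apply: inv_step. Qed.

Lemma step_stuck n st : inv st -> stuck n st -> step bas E n st = st.
Proof.
move=> Hst [Hno Nh]; rewrite /step; move/no_good_arcP: Hno; case: (good_arcs _ _ _ _) => // _.
have [[-> _] //|[t [le_t _ Ht _]]] := bfsP (cur st) (tgt st) n.
by case: (Nh t le_t).
Qed.

(** Needed besides [stepP], since [StepMisplaced] does not exclude a good arc in the initial
    state. *)
Lemma step_good n st : inv st -> ~ no_good_arc M (fam (cur st)) (fam (tgt st)) ->
  sdist (step bas E n st) < sdist st.
Proof.
move=> Hst Hg; have [fB fC] := inv_feasible Hst; rewrite /step.
case Eg: (good_arcs _ _ _ _) => [|a l] /=; first by case: Hg; apply/no_good_arcP; rewrite Eg.
have : a \in good_arcs bas E (cur st) (tgt st) by rewrite Eg mem_head.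
rewrite mem_filter notin_used mem_arcs -!in_fam; case: a {Eg} => i [f w] /= /andP[].
case/andP=> frf /andP[f_C w_C] a.
rewrite /sdist /= fam_repl //; last by rewrite -in_fam; case/and4P: a.
exact: (dist_good_move a).
Qed.

(** Moves of placed elements keep the distance and lower the hit level, so at most [t] of them
    occur; then a misplaced element is moved, and a good move follows at the latest. *)
Lemma hit_progress n t st : inv st -> t <= n -> hit M (fam (cur st)) (fam (tgt st)) t ->
  exists2 s, s <= t.+2 & sdist (iter s (step bas E n) st) < sdist st.
Proof.
elim/ltn_ind: t st => t IH st Hst le_t Ht; case: (stepP n Hst).
- by move=> _ lt_d; exists 1.
- move=> Hst' le_d Hg; exists 2 => //=; exact: leq_trans (step_good n Hst' Hg) le_d.
- move=> t' _ Nh lt_t' Hst' eq_d Ht'.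
  have lt_t : t' < t by rewrite ltnNge; apply/negP=> /Nh.
  have [s le_s lt_d] := IH t' lt_t _ Hst' (ltnW lt_t') Ht'.
  exists s.+1; first by lia.
  by rewrite iterSr -eq_d.
by case=> _ Nh; case: (Nh t).
Qed.

(** Each decrease of the distance takes at most [n.+2] steps: a first move of a placed element
    leaves a hit at a level below [n]. *)
Lemma reach_stuck n st : inv st ->
  exists2 s, s <= sdist st * n.+2 & stuck n (iter s (step bas E n) st).
Proof.
move: {2}_.+1 (ltnSn (sdist st)) => d; elim: d st => // d IH st lt_d Hst.
have more s : s <= n.+2 -> sdist (iter s (step bas E n) st) < sdist st ->
    exists2 s, s <= sdist st * n.+2 & stuck n (iter s (step bas E n) st).
  move=> le_s lt_s; have [|s' le_s' Hs'] := IH _ _ (inv_iter n s Hst).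
    exact: leq_trans lt_s _.
  exists (s' + s); last by rewrite iterD.
  apply: leq_trans (leq_add le_s' le_s) _; rewrite addnC -mulSn leq_mul2r lt_s orbT //.
case: (stepP n Hst).
- by move=> _ lt_s; apply: (more 1).
- move=> Hst' le_d Hg; apply: (more 2) => //=; exact: leq_trans (step_good n Hst' Hg) le_d.
- move=> t _ _ lt_t Hst' eq_d Ht.
  have [s le_s lt_s] := hit_progress Hst' (ltnW lt_t) Ht.
  by apply: (more s.+1); [lia | rewrite iterSr -eq_d].
by move=> Hstuck _; exists 0.
Qed.

Lemma iter_stuck n st N : inv st -> sdist st * n.+2 <= N -> stuck n (iter N (step bas E n) st).
Proof.
move=> Hst le_N; have [s le_s Hs] := reach_stuck n Hst.
have -> : N = N - s + s by lia.
rewrite iterD; elim: (N - s) => //= j Hj; rewrite step_stuck //.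
by rewrite -iterD; apply: inv_iter.
Qed.

Lemma size_hist1 n st j :
  size (hist1 (iter j (step bas E n) st)) <= size (hist1 st) + j.
Proof.
elim: j => [|j IH] /=; first by rewrite addn0.
apply: leq_trans (_ : (size (hist1 (iter j (step bas E n) st))).+1 <= _);
  last by rewrite addnS ltnS.
rewrite {1}/step; case: (good_arcs _ _ _ _) => //=; case: (bfs _ _ _ _ _).1 => //= a l.
by case: ifP.
Qed.

End Correctness.

(** * The final state decides reconfigurability *)

Section Solution.
Variables (T : finType) (k : nat) (M : 'I_k -> matroid T) (E B C : 'I_k -> seq T).
Hypotheses (E_ground : forall i, E i =i ground (M i)) (E_uniq : forall i, uniq (E i)).
Hypotheses (wB : wf E B) (wC : wf E C).
Hypotheses (fB : feasible M (fam B)) (fC : feasible M (fam C)).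
Local Notation bas := (fun i s => [set x in s] \in bases (M i)).
Local Notation run_final := (final bas E B C).

Lemma inv_init j : inv M E (fam B) (fam C) (iter j (step bas E (fuel E)) (init_state B C)).
Proof. by apply: inv_iter => //; split; rewrite //= !eqxx ?fB ?fC. Qed.

Lemma card_ground i : #|ground (M i)| = size (E i).
Proof. by rewrite -(eq_card (E_ground i)); apply/card_uniqP. Qed.

Lemma fuelE : fuel E = (\sum_i #|ground (M i)|).+2.
Proof.
rewrite /fuel size_flatten /shape -map_comp sumnE big_map big_enum /=.
by congr _.+2; apply: eq_bigr => i _; rewrite card_ground.
Qed.

Lemma final_stuck : stuck M (fuel E) run_final.
Proof.
apply: (iter_stuck E_ground (inv_init 0)).
have : sdist (init_state B C) <= \sum_i #|ground (M i)|.
  apply: leq_sum => i _; apply: leq_trans (subset_leq_card (subsetDl _ _)) _.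
  exact/subset_leq_card/bases_ground/feasible_basis.
by rewrite fuelE; set n := \sum_i _ => le_n; apply: leq_trans (leq_mul le_n (leqnn _)) _; lia.
Qed.

Lemma solution_walk : solution run_final <> [::] ->
  reconfiguration_sequence M (fam B) (fam C) [seq fam A | A <- solution run_final].
Proof.
rewrite /solution; case: nilP => // e _.
have Hinv := inv_init (fuel E * fuel E); rewrite -/run_final in Hinv.
have [f1 f2] := inv_feasible Hinv; case: Hinv => _ _ w1 w2.
have eq12 : fam (cur run_final) = fam (tgt run_final).
  by apply: dist0_eq f1 f2 _ => x; rewrite -mem_wrong e.
rewrite map_cat map_rev -behead_map; apply: walk_cat w2; rewrite -eq12.
exact: walk_rev.
Qed.

(** The history of a run is nonempty, so the final families differ. A walk from source to target,
    extended by the two histories, would join them; but the final state is stuck, and a misplaced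
    element lies in a blocked set, on which no walk changes the bases. *)
Lemma solution_nil : solution run_final = [::] -> ~ reconfigurable M (fam B) (fam C).
Proof.
rewrite /solution; case: nilP => [_|/eqP ne _].
  have [_ _ w1 _] := inv_init (fuel E * fuel E); rewrite -/run_final in w1.
  case: (hist1 _) w1 => //= A l _; rewrite rev_cons; by case: (rev l).
have Hinv := inv_init (fuel E * fuel E); rewrite -/run_final in Hinv.
have [f1 f2] := inv_feasible Hinv; case: Hinv => _ _ w1 w2.
case=> s ws.
have {}ws := walk_cat (walk_cat w1 ws) (walk_rev w2).
have [_ Nh] := final_stuck.
have [|D bD sD] := stuck_blocked f1 _ Nh.
  rewrite fuelE; apply/leqW/leqW.
  elim/big_ind2: _ => [|A1 n1 A2 n2 le1 le2|//]; first by rewrite cards0.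
  by apply: leq_trans (leq_card_setU _ _).1 (leq_add le1 le2).
case e: (wrong _ _) ne => [//|x l] _.
have /[dup] mx : misplaced (fam (cur run_final)) (fam (tgt run_final)) x.
  by rewrite -mem_wrong e mem_head.
move=> /sD xD; case/existsP: mx => i /andP[xB /negP[]].
by have /setP/(_ x) := blocked_walk bD ws i; rewrite !inE xB xD !andbT => <-.
Qed.

Lemma step_hist n (st : state T k) : (hist1 (step bas E n st) = hist1 st \/
    hist1 (step bas E n st) = cur (step bas E n st) :: hist1 st) /\
  (hist2 (step bas E n st) = hist2 st \/
    hist2 (step bas E n st) = tgt (step bas E n st) :: hist2 st).
Proof.
rewrite /step; case: (good_arcs _ _ _ _) => [|a l] /=; last by auto.
case: (bfs _ _ _ _ _).1 => [|a l] /=; first by auto.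
by case: ifP => _ /=; auto.
Qed.

(** Encoded sets must be duplicate-free lists, so well-formedness is tracked for all recorded
    families, beyond the current ones treated in [inv]. *)
Lemma wf_hist j : let st := iter j (step bas E (fuel E)) (init_state B C) in
  List.Forall (wf E) (hist1 st) /\ List.Forall (wf E) (hist2 st).
Proof.
elim: j => [|j [IH1 IH2]] /=; first by split; constructor.
have [wB' wC' _ _] := inv_init j.+1.
have [[->|->] [->|->]] := step_hist (fuel E) (iter j (step bas E (fuel E)) (init_state B C));
  split=> //; by constructor.
Qed.

Lemma Forall_rev (X : Type) (Q : X -> Prop) s : List.Forall Q s -> List.Forall Q (rev s).
Proof.
elim=> [|x l Qx _ IH]; first by constructor.
by rewrite rev_cons -cats1; apply/List.Forall_app; split=> //; constructor.
Qed.

Lemma wf_solution : List.Forall (wf E) (solution run_final).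
Proof.
rewrite /solution; case: nilP => _; last by constructor.
have [H1 H2] := wf_hist (fuel E * fuel E).
apply/List.Forall_app; split; first exact: Forall_rev.
by case: H2 => //=; constructor.
Qed.

End Solution.

(** * Encodings of families *)

Lemma encode_family (T : finType) k (B : 'I_k -> seq T) : (forall i, uniq (B i)) ->
  encodes_family (vfam B) (fam B).
Proof.
move=> uB; rewrite /encodes_family /vfam; elim: (enum _) => //= i s IH; split=> //.
by exists (B i); split=> // x; rewrite in_fam.
Qed.

Lemma encode_families (T : finType) k (s : seq ('I_k -> seq T)) :
  List.Forall (fun B => forall i, uniq (B i)) s ->
  encodes_families (vlist [seq vfam B | B <- s]) [seq fam B | B <- s].
Proof. by elim=> //= B l uB _ IH; split=> //; apply: encode_family. Qed.

(** The lists hidden in [v] are collected into one function of the index, by induction along a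
    duplicate-free list of indices, overriding the function at each new index. *)
Lemma decode_family (T : finType) k (v : value T) (A : 'I_k -> {set T}) :
  encodes_family v A ->
  exists2 B : 'I_k -> seq T, v = vfam B & forall i, uniq (B i) /\ B i =i A i.
Proof.
rewrite /encodes_family /vfam.
suff H (s : seq 'I_k) : uniq s -> forall v, encodes_seq (@encodes_set T) v [seq A i | i <- s] ->
    exists2 B : 'I_k -> seq T, v = vlist [seq velts (B i) | i <- s] &
      forall i, i \in s -> uniq (B i) /\ B i =i A i.
  by case/(H _ (enum_uniq _)) => B -> HB; exists B => // i; apply: HB; rewrite mem_enum.
elim: s => [|j s IH] /=; first by move=> _ [] // _; exists (fun=> [::]).
case/andP=> js us [] //= a w [[s0 [us0 es0 ->]] /(IH us)[B -> HB]].
exists (fun i => if i == j then s0 else B i).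
  rewrite eqxx; congr Pair; congr vlist; apply/eq_in_map => i i_s.
  by case: eqP => // eij; rewrite -eij i_s in js.
move=> i; rewrite inE; case: eqP => [-> _|_] //=; exact: HB.
Qed.

(** * Polynomial bounds *)

Lemma horner_nat_mono (p : {poly nat}) x y : x <= y -> p.[x]%R <= p.[y]%R.
Proof.
move=> le_xy; elim/poly_ind: p => [|p c IH]; first by rewrite !horner0.
by rewrite !hornerMXaddC leq_add2r leq_mul.
Qed.

(** The first summand serves for the lengths of lists, the second for the oracle. *)
Definition list_bound (q : {poly nat}) n := (n + 3) ^ 3 + q.[n]%R.
Definition list_bound_poly (q : {poly nat}) : {poly nat} := (('X + 3%N%:P) ^+ 3 + q)%R.
(** The exponent 9 comes from [cost 8], the bound for function 25; [c] will be the size of the main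
    expression. *)
Definition time_bound_poly (q : {poly nat}) (c : nat) : {poly nat} :=
  (c%:P * ((list_bound_poly q + 1%N%:P) * 200%N%:P) ^+ 9)%R.

Lemma list_bound_polyE q n : (list_bound_poly q).[n]%R = list_bound q n.
Proof. by rewrite /list_bound_poly !(hornerD, horner_exp, hornerX, hornerC). Qed.

Lemma time_bound_polyE q c n : (time_bound_poly q c).[n]%R = c * cost (list_bound q n) 8.
Proof.
rewrite /time_bound_poly !(hornerM, horner_exp, hornerC) hornerD list_bound_polyE hornerC.
by rewrite /cost -[in RHS]addn1.
Qed.

Section Instances.
Variables (I : instance) (tau : 'I_(num I) -> {set elt I} -> nat) (q : {poly nat}).
Hypothesis tauP : forall (i : 'I_(num I)) (X : {set elt I}),
  X \subset ground (mat i) -> tau i X <= q.[#|ground (mat i)|]%R.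
Variables (vE vB vC : value (elt I)).
Hypothesis vEP : encodes_family vE (fun i => ground (mat i)).
Hypothesis vBP : encodes_family vB (source I).
Hypothesis vCP : encodes_family vC (target I).
Local Notation m := (list_bound q (instance_size I)).

(** The main function is arbitrary, as the decision program and the search program share all the
    others. *)
Lemma solve_correct main :
  exists s : seq ('I_(num I) -> seq (elt I)),
  [/\ computes (basis_oracle (@mat I) tau) (main :: common) (cost m 8) 25 [:: vE; vB; vC]
        (vlist [seq vfam B | B <- s]),
      s <> [::] -> reconfiguration_sequence (@mat I) (source I) (target I) [seq fam B | B <- s],
      s = [::] -> ~ reconfigurable (@mat I) (source I) (target I) &
      encodes_families (vlist [seq vfam B | B <- s]) [seq fam B | B <- s]].
Proof.
have [E -> HE] := decode_family vEP; have [B -> HB] := decode_family vBP.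
have [C -> HC] := decode_family vCP.
have E_ground i : E i =i ground (mat i) by case: (HE i).
have E_uniq i : uniq (E i) by case: (HE i).
have eB : fam B = source I.
  by apply/ffunP=> i; apply/setP=> x; rewrite in_fam; case: (HB i).
have eC : fam C = target I.
  by apply/ffunP=> i; apply/setP=> x; rewrite in_fam; case: (HC i).
have fB : feasible (@mat I) (fam B) by rewrite eB source_feasible.
have fC : feasible (@mat I) (fam C) by rewrite eC target_feasible.
have wf_of (A : 'I_(num I) -> seq (elt I)) :
    feasible (@mat I) (fam A) -> (forall i, uniq (A i)) -> wf E A.
  move=> fA uA i; split=> // x xA; rewrite E_ground.
  by apply: (feasible_ground fA); rewrite in_fam.
have wB : wf E B by apply: wf_of => // i; case: (HB i).
have wC : wf E C by apply: wf_of => // i; case: (HC i).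
pose bas (i : 'I_(num I)) (s : seq (elt I)) := [set x in s] \in bases (mat i).
exists (solution (final bas E B C)); split.
- have sumN : \sum_(i < num I) #|ground (mat i)| <= instance_size I by apply: leq_addr.
  have EN i : size (E i) <= instance_size I.
    rewrite -(card_ground E_ground E_uniq) (leq_trans _ sumN) //.
    by rewrite (bigD1 i) //= leq_addr.
  have mN : (instance_size I + 3) ^ 3 <= m by apply: leq_addr.
  have leN : fuel E * fuel E + 1 <= (instance_size I + 3) ^ 3.
    rewrite (fuelE E_ground E_uniq); move: sumN; set n := \sum_i _; move: (instance_size I) => N.
    move=> le_n; apply: leq_trans (_ : N.+2 * N.+2 + 1 <= _); first by rewrite leq_add2r leq_mul.
    by rewrite !expnS; nia.
  apply: (@computes_solve _ _ _ _ _ _ (instance_size I)) => //.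
  + exact: leq_addl.
  + move=> i s sub_s sz_s.
    have sub : [set x in s] \subset ground (mat i).
      by apply/subsetP=> x; rewrite inE => /sub_s; rewrite E_ground.
    exists (tau i [set x in s]); last by rewrite /basis_oracle valK sub.
    apply: leq_trans (leq_add sz_s (tauP sub)) _; rewrite leq_add //.
      by rewrite !expnS; nia.
    apply: horner_nat_mono; rewrite -/(instance_size I) (card_ground E_ground E_uniq); exact: EN.
  + by apply: leq_trans mN; apply: leq_trans leN; rewrite mulnS; lia.
  + by move=> j; have [] := inv_init E_ground wB wC fB fC j.
  apply: leq_trans (size_hist1 _ _ _ _ _) _; rewrite /= addnC.
  exact: leq_trans leN mN.
- by rewrite -eB -eC; apply: solution_walk.
- by rewrite -eB -eC; apply: solution_nil.
apply: encode_families; have := wf_solution E_ground wB wC fB fC.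
by apply: List.Forall_impl => A wA i; case: (wA i).
Qed.

End Instances.

Definition solve_main := ECall 25 [:: EVar 0; EVar 1; EVar 2].
Definition decide_main := ELet solve_main (EIf (EVar 0) etrue ENil).

Theorem theorem1 :
  poly_time_algorithm
    (fun _ : instance => True)
    (fun (I : instance) (v : value (elt I)) =>
       exists2 b : bool, v = vbool (elt I) b &
         b <-> reconfigurable (@mat I) (source I) (target I))
  /\
  poly_time_algorithm
    (fun I : instance => reconfigurable (@mat I) (source I) (target I))
    (fun (I : instance) (v : value (elt I)) =>
       exists2 s : seq {ffun 'I_(num I) -> {set elt I}},
         reconfiguration_sequence (@mat I) (source I) (target I) s &
         encodes_families v s).
Proof.
split.
  exists (decide_main :: common) => q; exists (time_bound_poly q (expr_size decide_main)).
  move=> I tau vE vB vC tauP vEP vBP vCP _.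
  have [s [Hfn Hs Hnil _]] := solve_correct tauP vEP vBP vCP decide_main.
  pose b := ~~ nilp s.
  have [t le_t Ht] : evaluates (basis_oracle (@mat I) tau) (decide_main :: common)
      (cost (list_bound q (instance_size I)) 8) [:: vE; vB; vC] decide_main (vbool (elt I) b).
    eapply evaluates_let; first exact: cost_gt0.
      by apply: evaluates_call; [exact: cost_gt0 | by [] | exact: Hfn].
    apply: evaluates_if; [exact: cost_gt0 | by [] | |]; rewrite /= vtrue_vlist -/b => Hb;
      by apply: evaluates_ret; rewrite ?cost_gt0 //= ?Hb ?(negPf Hb).
  exists (vbool (elt I) b), t; split=> //; first by rewrite time_bound_polyE.
  exists b => //; split; rewrite /b.
    by move/nilP=> ne; exists [seq fam B | B <- s]; apply: Hs.
  by move=> Hr; apply/nilP => e; case: (Hnil e).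
exists (solve_main :: common) => q; exists (time_bound_poly q (expr_size solve_main)).
move=> I tau vE vB vC tauP vEP vBP vCP Hr.
have [s [Hfn Hs Hnil Henc]] := solve_correct tauP vEP vBP vCP solve_main.
have [t le_t Ht] : evaluates (basis_oracle (@mat I) tau) (solve_main :: common)
    (cost (list_bound q (instance_size I)) 8) [:: vE; vB; vC] solve_main
    (vlist [seq vfam B | B <- s]).
  by apply: evaluates_call; [exact: cost_gt0 | by [] | exact: Hfn].
exists (vlist [seq vfam B | B <- s]), t; split=> //; first by rewrite time_bound_polyE.
by exists [seq fam B | B <- s] => //; apply: Hs => e; case: (Hnil e).
Qed.
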